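(* Suppose $0<r\le p<q<\infty$ and $r\le1$. Let $\Omega$ be a compact Hausdorff space, let $Y$ be an $r$-Banach space, and let $T:C(\Omega)\to Y$ be a bounded linear operator. Then the following conditions on $T$ are equivalent: (i) There is a constant $C_1$ so that for any $f_1,\dots,f_n\in C(\Omega)$ with disjoint supports, $\bigl(\sum_{i=1}^n\|Tf_i\|^q\bigr)^{1/q}\le C_1\max_{1\le i\le n}\|f_i\|$. (ii) There is a constant $C_2$ so that for any $f_1,\dots,f_n\in C(\Omega)$, $\bigl(\sum_{i=1}^n\|Tf_i\|^q\bigr)^{1/q}\le C_2\bigl\|(\sum_{i=1}^n|f_i|^p)^{1/p}\bigr\|$. (iii) There are a constant $C_3$ and a probability measure $\mu$ on $\Omega$ such that for all $f\in C(\Omega)$, $\|Tf\|\le C_3\|f\|^{1-p/q}\bigl(\int|f|^p\,d\mu\bigr)^{1/q}$. (iv) There are a constant $C_4$ and a probability measure $\mu$ on $\Omega$ such that for all $f\in C(\Omega)$, $\|Tf\|\le C_4\|f\|_{L_{q,r}(\mu)}$.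
   Context: $C(\Omega)$ is the space of continuous real functions on $\Omega$ with the supremum norm $\|\cdot\|$. Probability measures on $\Omega$ are Borel probability measures. An $r$-Banach space ($0<r\le1$) is a quasi-Banach space whose quasi-norm satisfies $\|x+y\|^r\le\|x\|^r+\|y\|^r$. For a finite measure $\mu$ and $0<q,r<\infty$ the Lorentz quasi-norm is $$\|f\|_{L_{q,r}(\mu)}=\Bigl(\int_0^\infty\frac rq\,t^{r/q-1}f^*(t)^r\,dt\Bigr)^{1/r},\qquad f^*(t)=\inf_{\mu(E)\le t}\ \sup_{\omega\notin E}|f(\omega)|,$$ where $f^*$ is the decreasing rearrangement of $|f|$ (the infimum is over measurable sets $E$, and the supremum over the empty set is $0$). *)

(* Defs.v *)
From HB Require Import structures.
From mathcomp Require Import all_boot all_order all_algebra.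
From mathcomp Require Import all_classical all_reals all_analysis.

Set Implicit Arguments.
Unset Strict Implicit.
Unset Printing Implicit Defensive.

Import Order.TTheory GRing.Theory Num.Theory.
Import numFieldNormedType.Exports.

Local Open Scope classical_set_scope.
Local Open Scope ring_scope.

(* [continuousType Omega R] as the vector space C(Omega), with the pointwise
   operations inherited from [Omega -> R]. *)
Section continuous_functions_lmodType.
Context (R : realType) (Omega : topologicalType).

Definition cfun_pred : {pred Omega -> R} :=
  mem [set f : Omega -> R | continuous f].

Definition cfun_Sub (f : Omega -> R) (cf : f \in cfun_pred) :
  continuousType Omega R := mkcts (set_mem cf).

Lemma cfun_rect (K : continuousType Omega R -> Type) :
  (forall f (cf : f \in cfun_pred), K (cfun_Sub cf)) ->
  forall f : continuousType Omega R, K f.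
Proof.
move=> KSub f.
have cf : (f : Omega -> R) \in cfun_pred by apply: mem_set; exact: cts_fun.
have <- : cfun_Sub cf = f by exact/continuousEP.
exact: KSub.
Qed.

Lemma cfun_SubK (f : Omega -> R) (cf : f \in cfun_pred) :
  (cfun_Sub cf : Omega -> R) = f.
Proof. by []. Qed.

HB.instance Definition _ := @isSub.Build (Omega -> R) (mem cfun_pred)
  (continuousType Omega R) (@Continuous.sort Omega R) cfun_Sub
  cfun_rect cfun_SubK.

Lemma cfun_submod_closed : submod_closed cfun_pred.
Proof.
split; first by apply: mem_set => x; exact: cvg_cst.
move=> a f g /set_mem cf /set_mem cg; apply: mem_set => x.
by apply: cvgD; [apply: cvgZr; exact: cf|exact: cg].
Qed.

HB.instance Definition _ := GRing.isSubmodClosed.Build R (Omega -> R)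
  cfun_pred cfun_submod_closed.

HB.instance Definition _ :=
  [SubChoice_isSubLmodule of continuousType Omega R by <:].

End continuous_functions_lmodType.

Definition sup_norm {R : realType} {X : Type} (f : X -> R) : R :=
  sup (range (fun x => `|f x|)).

Definition supp {R : realType} {X : topologicalType} (f : X -> R) : set X :=
  closure [set x | f x != 0].

Record r_banach {R : realType} (r : R) {Y : lmodType R} (N : Y -> R) : Prop := {
  quasi_norm_ge0 : forall x, 0 <= N x;
  quasi_norm_eq0 : forall x, N x = 0 -> x = 0;
  quasi_normZ : forall a x, N (a *: x) = `|a| * N x;
  quasi_norm_triangle : exists K, forall x y, N (x + y) <= K * (N x + N y);
  r_triangle : forall x y, N (x + y) `^ r <= N x `^ r + N y `^ r;
  quasi_norm_complete : forall u : nat -> Y,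
    (forall e : R, 0 < e -> \forall m & n \near \oo, N (u m - u n) < e) ->
    exists l, (fun n => N (u n - l)) @ \oo --> 0
}.

(* [Omega] with its Borel sigma-algebra.  The measurable types of the library
   are pointed, so [Omega] has to be a [ptopologicalType]. *)
Notation borel Omega := (g_sigma_algebraType (@open Omega)).

Section lorentz.
Local Open Scope ereal_scope.
Context d (X : measurableType d) (R : realType).

(* Adding 0 makes the supremum over the empty set equal to 0, not -oo. *)
Definition rearrangement (mu : {measure set X -> \bar R}) (f : X -> R) (t : R)
    : \bar R :=
  ereal_inf [set ereal_sup (0 |` [set `|f x|%:E | x in ~` E]) |
             E in [set E | measurable E /\ mu E <= t%:E]].

Definition lorentz_norm (q r : R) (mu : {measure set X -> \bar R}) (f : X -> R)
    : \bar R :=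
  (\int[lebesgue_measure]_(t in `]0%R, +oo[)
     ((r / q * t `^ (r / q - 1))%:E * rearrangement mu f t `^ r)) `^ r^-1.

End lorentz.

(* Main.v *)
(** The heart of the matter is that (i) yields a probability measure mu with
    ||T f|| <= K ||f|| mu(supp f)^(1/q).  Cutting f into the layers
    ||f|| / 2^(k+1) <= |f| <= ||f|| / 2^k, this implies both (iii) and (iv).
    Summing (iii) gives (ii), and (ii) and (iv) are easily applied to functions
    with disjoint supports.

    Put L f = ||T f||^r, which is subadditive, and alpha = q / r.  By Hahn-Banach
    and the Riesz construction, mu exists as soon as sum_j c_j L(f_j)^alpha <= C
    whenever c_j >= 0, |f_j| <= 1 and sum_j c_j 1_(supp f_j) <= 1.  Since (i)
    makes L exhaustive, the supports may be replaced, up to sets on which L is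
    small, by unions of finitely many disjoint closed sets.  This reduces the
    bound to one on a subadditive set function h on a finite set I such that
    sum_B h(B)^alpha <= C0 over disjoint families: if sum_j c_j 1_(A_j) <= 1,
    then sum_j c_j h(A_j)^alpha <= C.

    Let K be the best C there.  Duality provides weights w of total mass K with
    h(A)^alpha <= w(A) for all A.  If h(A)^alpha >= 3/4 w(A), then subadditivity
    gives h(B)^alpha >= c w(A) for all B in A with w(B) > w(A) / 2, where
    c = ((3/4)^(1/alpha) - (1/2)^(1/alpha))^alpha.  A maximal union U of disjoint
    sets B with h(B)^alpha >= c w(B) thus meets every such A in at least half of
    its mass, while w(U) <= C0 / c.  Hence K <= 3/4 K + C0 / c. *)

Require Import Defs.
From HB Require Import structures.
From mathcomp Require Import all_boot all_order all_algebra.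
From mathcomp Require Import all_classical all_reals all_analysis.
From mathcomp Require Import measurable_realfun.
From mathcomp Require Import ring lra.

Set Implicit Arguments.
Unset Strict Implicit.
Unset Printing Implicit Defensive.

Import Order.TTheory GRing.Theory Num.Theory.
Import numFieldNormedType.Exports.

Local Open Scope classical_set_scope.
Local Open Scope ring_scope.

(** * Hahn-Banach theorem and its use as linear programming duality *)

Section hahn_banach.
Context (R : realType) (V : lmodType R).

Definition sublinear (p : V -> R) :=
  (forall x y, p (x + y) <= p x + p y) /\
  (forall t x, 0 < t -> p (t *: x) = t * p x).

Lemma sublinear0 p : sublinear p -> p 0 = 0.
Proof. by move=> [_ pZ]; have := pZ 2 0 ltac:(lra); rewrite scaler0; lra. Qed.

Lemma sublinear_ge p x : sublinear p -> - p (- x) <= p x.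
Proof.
by move=> sp; have := sp.1 x (- x); rewrite subrr sublinear0//; lra.
Qed.

(** Subadditivity survives because [P] is a chain: given [f] used at [x] and [g] used at [y], the
    smaller of the two can be used at both points. *)
Lemma sublinear_inf (P : set (V -> R)) (p0 : V -> R) :
  P p0 -> P `<=` sublinear -> total_on P (fun f g => forall x, g x <= f x) ->
  (forall x, has_lbound [set f x | f in P]) ->
  sublinear (fun x => inf [set f x | f in P]).
Proof.
move=> Pp0 Psub tot lb.
have ne x : [set f x | f in P] !=set0 by exists (p0 x), p0.
split=> [x y|t x t0].
  rewrite -lerBlDr; apply: lb_le_inf => // _ [f Pf <-].
  rewrite lerBlDr -lerBlDl; apply: lb_le_inf => // _ [g Pg <-].
  rewrite lerBlDl.
  have [fg|gf] := tot _ _ Pf Pg.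
    apply: (@le_trans _ _ (g (x + y))).
      by apply: ge_inf => //; exists g.
    apply: (le_trans ((Psub _ Pg).1 x y)); rewrite lerD2r; exact: fg.
  apply: (@le_trans _ _ (f (x + y))).
    by apply: ge_inf => //; exists f.
  by apply: (le_trans ((Psub _ Pf).1 x y)); rewrite lerD2l; exact: gf.
apply/eqP; rewrite eq_le; apply/andP; split.
  rewrite -ler_pdivrMl//; apply: lb_le_inf => // _ [f Pf <-].
  rewrite ler_pdivrMl// -(Psub _ Pf).2//.
  by apply: ge_inf => //; exists f.
apply: lb_le_inf => // _ [f Pf <-].
rewrite (Psub _ Pf).2// ler_pM2l//.
by apply: ge_inf => //; exists f.
Qed.

(* A minimal sublinear functional [q] is linear: for each [x], the functional
   [v |-> inf_(t >= 0) (q (v + t x) - t q x)] is sublinear and below [q]. *)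
Lemma sublinear_minimal_linear (q : V -> R) : sublinear q ->
  (forall q', sublinear q' -> (forall x, q' x <= q x) -> q' = q) ->
  linear (q : V -> R^o).
Proof.
move=> sq qmin.
have add x v : q (v + x) = q v + q x.
  pose S w := [set q (w + t *: x) - t * q x | t in [set t : R | 0 <= t]].
  have lb w : lbound (S w) (- q (- w)).
    move=> _ [t /= t0 <-].
    have := sq.1 (- w) (w + t *: x); rewrite addKr.
    have /predU1P[<-|tp] : (0 == t) || (0 < t) by rewrite -le_eqVlt.
      by rewrite scale0r sublinear0//; lra.
    by rewrite sq.2//; lra.
  have lb' w : has_lbound (S w) by exists (- q (- w)).
  have ne w : S w !=set0 by exists (q (w + 0 *: x) - 0 * q x), 0 => /=.
  have leS w t : 0 <= t -> inf (S w) <= q (w + t *: x) - t * q x.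
    by move=> t0; apply: ge_inf => //; exists t.
  have sq' : sublinear (fun w => inf (S w)).
    split=> [w z|t w t0].
      rewrite -lerBlDr; apply: lb_le_inf => // _ [s /= s0 <-].
      rewrite lerBlDr -lerBlDl; apply: lb_le_inf => // _ [t /= t0 <-].
      rewrite lerBlDl.
      apply: le_trans (leS _ (s + t) (addr_ge0 s0 t0)) _.
      have := sq.1 (w + s *: x) (z + t *: x).
      by rewrite addrACA -scalerDl mulrDl; lra.
    apply/eqP; rewrite eq_le; apply/andP; split.
      rewrite -ler_pdivrMl//; apply: lb_le_inf => // _ [s /= s0 <-].
      rewrite ler_pdivrMl//.
      apply: le_trans (leS _ (t * s) (mulr_ge0 (ltW t0) s0)) _.
      by rewrite -scalerA -scalerDr sq.2// mulrBr mulrA.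
    apply: lb_le_inf => // _ [s /= s0 <-].
    rewrite -ler_pdivlMl//.
    apply: le_trans (leS _ (t^-1 * s) _) _.
      by rewrite mulr_ge0// invr_ge0 ltW.
    have -> : w + (t^-1 * s) *: x = t^-1 *: (t *: w + s *: x).
      by rewrite scalerDr !scalerA mulVf ?gt_eqF// scale1r.
    by rewrite sq.2 ?invr_gt0// mulrBr mulrA.
  (* Taking [t = 0] shows that the infimum lies below [q], so minimality identifies the two. Then
     [t = 1] gives [q v <= q (v + x) - q x], the reverse of subadditivity. *)
  have /(congr1 (@^~ v)) /= qv : (fun w => inf (S w)) = q.
    apply: qmin => // w; apply: le_trans (leS w 0 _) _ => //.
    by rewrite scale0r addr0 mul0r subr0.
  have := leS v 1 ler01; rewrite qv scale1r mul1r.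
  by have := sq.1 v x; lra.
have qN x : q (- x) = - q x.
  by have := add (- x) x; rewrite subrr sublinear0//; lra.
move=> t x y; rewrite add; congr (_ + _).
have [t0|t0|<-] := ltgtP 0 t.
- exact: sq.2.
- by rewrite -[t]opprK scaleNr qN sq.2 ?oppr_gt0// scaleNr.
- by rewrite !scale0r sublinear0.
Qed.

(** Zorn's lemma is applied to the sublinear functionals below [p], with the order reversed so that
    maximal elements are pointwise minimal. A chain is bounded by its pointwise infimum, or by [p]
    if it is empty, and a minimal element is linear. *)
Lemma hahn_banach (p : V -> R) : sublinear p ->
  exists f : {linear V -> R^o}, forall x, f x <= p x.
Proof.
move=> sp.
pose D := {q : V -> R | sublinear q /\ forall x, q x <= p x}.
pose Rel (f g : D) := `[< forall x, sval g x <= sval f x >].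
have [||||q qmin] := @Zorn D Rel.
- by move=> q; apply/asboolP.
- move=> q1 q2 q3 /asboolP h1 /asboolP h2; apply/asboolP => x.
  exact: le_trans (h2 x) (h1 x).
- move=> [q1 P1] [q2 P2] /asboolP/= h1 /asboolP/= h2; apply: eq_exist => /=.
  by apply/funext => x; apply/eqP; rewrite eq_le h2 h1.
- move=> A totA.
  have [[q0 Aq0]|] := pselect (A !=set0); last first.
    move=> /set0P/negP; rewrite negbK => /eqP A0.
    have pp : sublinear p /\ forall x, p x <= p x by split.
    by exists (exist _ p pp) => s; rewrite A0.
  pose P := [set sval q | q in A].
  have Psub : P `<=` sublinear by move=> _ [q Aq <-]; exact: (svalP q).1.
  have lb x : has_lbound [set f x | f in P].
    exists (- p (- x)) => _ [_ [q Aq <-] <-].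
    apply: le_trans (sublinear_ge x (svalP q).1).
    by rewrite lerN2; exact: (svalP q).2.
  have sinf : sublinear (fun x => inf [set f x | f in P]).
    apply: (@sublinear_inf P (sval q0)) => //; first by exists q0.
    move=> _ _ [f Af <-] [g Ag <-].
    by have [/asboolP|/asboolP] := totA _ _ Af Ag; [left|right].
  have le q x : A q -> inf [set f x | f in P] <= sval q x.
    by move=> Aq; apply: ge_inf => //; exists (sval q) => //; exists q.
  have pp : sublinear (fun x => inf [set f x | f in P]) /\
      forall x, inf [set f x | f in P] <= p x.
    by split=> // x; apply: le_trans (le q0 x Aq0) _; exact: (svalP q0).2.
  exists (exist _ (fun x => inf [set f x | f in P]) pp) => s As.
  by apply/asboolP => x /=; exact: le.
have lin : linear (sval q : V -> R^o).
  apply: sublinear_minimal_linear; first exact: (svalP q).1.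
  move=> q' sq' leq'.
  have pp : sublinear q' /\ forall x, q' x <= p x.
    by split=> // x; apply: le_trans (leq' x) _; exact: (svalP q).2.
  by have <- := qmin (exist _ q' pp) (introT (asboolP _) leq').
pose f := GRing.isLinear.Build _ _ _ _ (sval q : V -> R^o) lin.
exists (HB.pack (sval q : V -> R^o) f : {linear V -> R^o}) => x /=.
exact: (svalP q).2.
Qed.

End hahn_banach.

(** * Duality for fractional packings *)

Section fractional_duality.
Context (R : realType) (X J : Type) (a : J -> X -> R) (b : J -> R).

(** Finitely supported weights are lists of pairs (coefficient, index). Indices may repeat, so that
    concatenation adds weights. *)
Definition wsum (F : J -> R) (l : seq (R * J)) := \sum_(i <- l) i.1 * F i.2.

Definition nneg_weights (l : seq (R * J)) := all (fun i => 0 <= i.1) l.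

(** [K] bounds the value of a linear program: maximise [sum_j c_j b_j] over [c >= 0] with
    [sum_j c_j a_j <= 1] at every point. *)
Definition packing_bound (K : R) := forall l, nneg_weights l ->
  (forall x, wsum (a^~ x) l <= 1) -> wsum b l <= K.

Definition scale_weights (t : R) (l : seq (R * J)) :=
  [seq (t * i.1, i.2) | i <- l].

Lemma wsum_scale F t l : wsum F (scale_weights t l) = t * wsum F l.
Proof.
by rewrite /wsum big_map mulr_sumr; apply: eq_bigr => i _ /=; rewrite mulrA.
Qed.

Lemma wsum_cat F l1 l2 : wsum F (l1 ++ l2) = wsum F l1 + wsum F l2.
Proof. by rewrite /wsum big_cat. Qed.

Lemma nneg_scale t l : 0 <= t -> nneg_weights l ->
  nneg_weights (scale_weights t l).
Proof.
move=> t0; rewrite /nneg_weights all_map; apply: sub_all => i /= i0.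
exact: mulr_ge0.
Qed.

Lemma nneg_cat l1 l2 : nneg_weights l1 -> nneg_weights l2 ->
  nneg_weights (l1 ++ l2).
Proof. by rewrite /nneg_weights all_cat => -> ->. Qed.

Lemma wsum_ge0 (F : J -> R) l : (forall j, 0 <= F j) -> nneg_weights l ->
  0 <= wsum F l.
Proof.
move=> F0; rewrite /wsum; elim: l => [|i l IH]; first by rewrite big_nil.
by rewrite big_cons => /andP[i0 /IH]; apply: addr_ge0; exact: mulr_ge0.
Qed.

Lemma wsum_le (F G : J -> R) l : (forall j, F j <= G j) ->
  nneg_weights l -> wsum F l <= wsum G l.
Proof.
move=> FG; rewrite /wsum; elim: l => [|i l IH]; first by rewrite !big_nil.
by rewrite !big_cons => /andP[i0 /IH]; apply: lerD; exact: ler_wpM2l.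
Qed.

Hypothesis a_ge0 : forall j x, 0 <= a j x.

Lemma packing_bound_scale K s l : packing_bound K -> nneg_weights l ->
  0 <= s -> (forall x, wsum (a^~ x) l <= s) -> wsum b l <= K * s.
Proof.
move=> Kb l0 + ls; rewrite le_eqVlt => /predU1P[s0|s0].
  rewrite -s0 mulr0 leNgt; apply/negP => wb0.
  (* With right-hand side 0 every multiple of [l] is admissible; this one would have value
     [|K| + 1], which exceeds [K]. *)
  pose t := (`|K| + 1) / wsum b l.
  have t0 : 0 < t by rewrite divr_gt0// ltr_wpDl.
  have := Kb _ (nneg_scale (ltW t0) l0).
  rewrite wsum_scale divfK ?gt_eqF// => /(_ _)/wrap[x|].
    rewrite wsum_scale; apply: le_trans ler01.
    by rewrite pmulr_rle0// s0.
  by have := ler_norm K; lra.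
have := Kb _ (nneg_scale _ l0); rewrite -ler_pdivrMr// mulrC => /(_ s^-1).
rewrite wsum_scale; apply; first by rewrite invr_ge0 ltW.
by move=> x; rewrite wsum_scale ler_pdivrMl// mulr1.
Qed.

Context (V : lmodType R) (ev : V -> X -> R) (e : V) (x0 : X).
Hypothesis evP : forall k u v x, ev (k *: u + v) x = k * ev u x + ev v x.
Hypothesis ev1 : forall x, ev e x = 1.
Hypothesis ev_bounded : forall v, exists M, forall x, `|ev v x| <= M.

Let evD u v x : ev (u + v) x = ev u x + ev v x.
Proof. by rewrite -[u]scale1r evP mul1r scale1r. Qed.

Let ev0 x : ev 0 x = 0.
Proof. by have := evD 0 0 x; rewrite addr0; lra. Qed.

Let evZ k u x : ev (k *: u) x = k * ev u x.
Proof. by rewrite -[k *: u]addr0 evP ev0 addr0. Qed.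

(** The infimum of [S K v] over all pairs is the sublinear functional to which Hahn-Banach is
    applied: the cost [t K] of dominating [sum_j c_j a_j + v] by a constant [t], minus the gain
    [sum_j c_j b_j]. *)
Let S K v := [set tl.1 * K - wsum b tl.2 | tl in [set tl : R * seq (R * J) |
  nneg_weights tl.2 /\ forall x, wsum (a^~ x) tl.2 + ev v x <= tl.1]].

Let S_lb K v M : packing_bound K -> (forall x, `|ev v x| <= M) ->
  lbound (S K v) (- (K * M)).
Proof.
move=> Kb vM _ [[t l] [/= l0 tl] <-].
have lM x : wsum (a^~ x) l <= t + M.
  by have := tl x; have := vM x; rewrite ler_norml; lra.
have tM : 0 <= t + M.
  by apply: le_trans (lM x0); exact: wsum_ge0.
by have := packing_bound_scale Kb l0 tM lM; lra.
Qed.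

(** Each property is read off from [f <= p] at one admissible pair: [(1, [::])] for [e] and [(-1,
    [::])] for [- e] give [f e = K], [(0, [::])] for [- v] gives positivity, and [(0, [:: (1, j)])]
    for [- v] gives [b j <= f v]. The space [V] will be the functions on a finite set, and later
    [C(Omega)]. *)
Lemma packing_functional K : 0 <= K -> packing_bound K ->
  exists f : {linear V -> R^o},
    [/\ f e = K, forall v, (forall x, 0 <= ev v x) -> 0 <= f v &
        forall j v, (forall x, a j x <= ev v x) -> b j <= f v].
Proof.
move=> K0 Kb.
have lb v : has_lbound (S K v).
  by have [M vM] := ev_bounded v; exists (- (K * M)); exact: S_lb.
have ne v : S K v !=set0.
  have [M vM] := ev_bounded v; exists (M * K - wsum b [::]), (M, [::]) => //=.
  by split=> // x; rewrite /wsum big_nil add0r (le_trans (ler_norm _)).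
have leS v t l : nneg_weights l ->
    (forall x, wsum (a^~ x) l + ev v x <= t) -> inf (S K v) <= t * K - wsum b l.
  by move=> l0 lv; apply: ge_inf => //; exists (t, l).
pose p v := inf (S K v).
have sp : sublinear p.
  split=> [u v|t v t0].
    rewrite -lerBlDr; apply: lb_le_inf => // _ [[t1 l1] /= [l10 tl1] <-].
    rewrite lerBlDr -lerBlDl; apply: lb_le_inf => // _ [[t2 l2] /= [l20 tl2] <-].
    rewrite lerBlDl.
    apply: le_trans (leS _ (t1 + t2) (l1 ++ l2) (nneg_cat l10 l20) _) _.
      move=> x; rewrite wsum_cat evD addrACA; exact: lerD.
    by rewrite wsum_cat mulrDl; lra.
  apply/eqP; rewrite eq_le; apply/andP; split.
    rewrite -ler_pdivrMl//; apply: lb_le_inf => // _ [[s l] /= [l0 sl] <-].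
    rewrite ler_pdivrMl//.
    apply: le_trans (leS _ (t * s) _ (nneg_scale (ltW t0) l0) _) _.
      by move=> x; rewrite wsum_scale evZ -mulrDr ler_pM2l.
    by rewrite wsum_scale mulrBr mulrA.
  apply: lb_le_inf => // _ [[s l] /= [l0 sl] <-].
  rewrite -ler_pdivlMl//.
  have t'0 : 0 <= t^-1 by rewrite invr_ge0 ltW.
  apply: le_trans (leS _ (t^-1 * s) _ (nneg_scale t'0 l0) _) _.
    move=> x; rewrite wsum_scale ler_pdivlMl// mulrDr mulrA divff ?gt_eqF//.
    by rewrite mul1r -evZ.
  by rewrite wsum_scale mulrBr mulrA.
have [f fp] := hahn_banach sp; exists f.
have fN v : f (- v) = - f v by exact: linearN.
have pos v : (forall x, 0 <= ev v x) -> 0 <= f v.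
  move=> v0; rewrite -oppr_le0 -fN; apply: le_trans (fp _) _.
  have := leS (- v) 0 [::] isT; rewrite mul0r /wsum !big_nil subrr; apply.
  by move=> x; rewrite big_nil add0r -scaleN1r evZ mulN1r oppr_le0.
split=> // [|j v jv].
  apply/eqP; rewrite eq_le; apply/andP; split.
    apply: le_trans (fp _) _.
    have := leS e 1 [::] isT; rewrite mul1r /wsum !big_nil subr0; apply.
    by move=> x; rewrite big_nil add0r ev1.
  rewrite -lerN2 -fN; apply: le_trans (fp _) _.
  have := leS (- e) (-1) [::] isT; rewrite mulN1r /wsum !big_nil subr0; apply.
  by move=> x; rewrite big_nil add0r -scaleN1r evZ mulN1r ev1.
rewrite -lerN2 -fN; apply: le_trans (fp _) _.
have := leS (- v) 0 [:: (1, j)]; rewrite /nneg_weights /= ler01 => /(_ isT).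
rewrite mul0r /wsum big_seq1 /= mul1r sub0r; apply.
by move=> x; rewrite big_seq1 /= mul1r -scaleN1r evZ mulN1r subr_le0.
Qed.

End fractional_duality.

(** * Packing bound for set functions on a finite set *)

Section finite_packing.
Context (R : realType) (I : finType) (h : {set I} -> R) (alpha C0 : R).
Hypothesis alpha_gt0 : 0 < alpha.
Hypothesis h_ge0 : forall A, 0 <= h A.
Hypothesis h0 : h finset.set0 = 0.
Hypothesis hU : forall A B, h (A :|: B) <= h A + h B.
Hypothesis h_disjoint : forall P : {set {set I}}, finset.trivIset P ->
  \sum_(B in P) h B `^ alpha <= C0.

Let ind (A : {set I}) (x : I) : R := (x \in A)%:R.
Let b (A : {set I}) := h A `^ alpha.

Let ind_ge0 A x : 0 <= ind A x. Proof. exact: ler0n. Qed.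

Let s := alpha^-1.
Definition packing_ratio : R := ((3/4) `^ s - (1/2) `^ s) `^ alpha.

Let s_gt0 : 0 < s. Proof. by rewrite invr_gt0. Qed.

Let ratio_root_gt0 : 0 < (3/4 : R) `^ s - (1/2) `^ s.
Proof. by rewrite subr_gt0 gt0_ltr_powR// ?nnegrE; lra. Qed.

Lemma packing_ratio_gt0 : 0 < packing_ratio.
Proof. exact: powR_gt0. Qed.

Let C0_ge0 : 0 <= C0.
Proof.
have := h_disjoint (P := finset.set0); rewrite big_set0; apply.
by apply/finset.trivIsetP => A B; rewrite inE.
Qed.

(** Double counting: the sums over sets and over points are exchanged. A packing condition thereby
    bounds the left side by the mass of [D]. *)
Lemma wsum_mass (w : I -> R) (D : {set I}) l :
  wsum (fun A => \sum_(x in A :&: D) w x) l =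
  \sum_(x in D) w x * wsum (ind^~ x) l.
Proof.
rewrite /wsum; under eq_bigr do rewrite mulr_sumr.
under [RHS]eq_bigr do rewrite mulr_sumr.
rewrite [RHS]exchange_big; apply: eq_bigr => i _ /=.
rewrite big_mkcond [RHS]big_mkcond; apply: eq_bigr => x _.
rewrite finset.in_setI andbC /ind; case: (x \in D) => //=.
by case: (x \in i.2); rewrite ?mulr1 ?mulr0// mulrC.
Qed.

(** A crude bound, from [b A <= C0 <= C0 * #|A|] for nonempty [A]. It guarantees that some bound
    exists, and it settles the case of empty [I]. *)
Let packing_bound_card : packing_bound ind b (C0 * #|I|%:R).
Proof.
move=> l l0 l1.
pose F (A : {set I}) := \sum_(x in A :&: [set: I]) C0.
apply: (@le_trans _ _ (wsum F l)).
  apply: wsum_le => // A; rewrite /F finset.setIT.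
  have [->|/finset.set0Pn[x Ax]] := eqVneq A finset.set0.
    by rewrite big_set0 /b h0 powR0// gt_eqF.
  have := h_disjoint (P := [set A]).
  rewrite big_set1 => /(_ _)/le_trans; apply.
    by apply/finset.trivIsetP => B B'; rewrite !inE => /eqP -> /eqP ->; rewrite eqxx.
  by rewrite (bigD1 x)//= lerDl sumr_ge0.
rewrite wsum_mass mulr_natr -cardsT -sumr_const; apply: ler_sum => x _.
by rewrite ler_piMr.
Qed.

Let packing_bound_improve (x0 : I) (K : R) : 0 <= K -> packing_bound ind b K ->
  packing_bound ind b (3/4 * K + C0 / packing_ratio).
Proof.
move=> K0 Kb l l0 l1.
pose ev (v : {ffun I -> R^o}) (x : I) : R := v x.
have [|||f [fK f_ge0 f_ge]] := @packing_functional R I {set I} ind b ind_ge0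
  {ffun I -> R^o} ev [ffun=> 1] x0 _ _ _ K K0 Kb.
- by move=> k u v x; rewrite /ev !ffunE.
- by move=> x; rewrite /ev ffunE.
- move=> v; exists (\sum_x `|v x|) => x; rewrite /ev (bigD1 x)//= lerDl.
  exact: sumr_ge0.
(* On a finite set the dual functional is a measure: [w] gives its point masses, [m] its values on
   sets, and its total mass is [K]. *)
pose w x : R := f [ffun y => (y == x)%:R].
pose m (A : {set I}) := \sum_(x in A) w x.
have w0 x : 0 <= w x.
  by apply: f_ge0 => y; rewrite /ev ffunE ler0n.
have m0 A : 0 <= m A by exact: sumr_ge0.
have fm (A : {set I}) : f [ffun y => (y \in A)%:R] = m A.
  rewrite /m /w -linear_sum; congr (f _); apply/ffunP => y.
  rewrite ffunE sum_ffunE; under eq_bigr do rewrite ffunE.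
  have [Ay|Ay] := boolP (y \in A).
    rewrite (bigD1 y)//= eqxx big1 ?addr0// => x /andP[_ /negbTE].
    by rewrite eq_sym => ->.
  by rewrite big1// => x Ax; case: eqP => // yx; rewrite yx Ax in Ay.
have mT : m finset.setT = K.
  by rewrite -fm -fK; congr (f _); apply/ffunP => y; rewrite !ffunE inE.
have bm A : b A <= m A.
  by rewrite -fm; apply: f_ge => x; rewrite /ev ffunE.
pose good A := 3/4 * m A <= b A.
(* Candidates for [U]: disjoint unions of nonempty sets on which [b] is at least [packing_ratio]
   times the mass. Finiteness of [I] provides one of maximal cardinality. *)
pose Q (U : {set I}) := [exists P : {set {set I}}, [&& finset.trivIset P,
  finset.set0 \notin P, finset.cover P == U &
  [forall B in P, packing_ratio * m B <= b B]]].
have Q0 : Q finset.set0.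
  apply/existsP; exists finset.set0; apply/and4P; split.
  - by apply/finset.trivIsetP => A B; rewrite inE.
  - by rewrite inE.
  - by rewrite /finset.cover big_set0.
  - by apply/forall_inP => B; rewrite inE.
have [U QU Umax] : exists2 U, Q U & forall U', Q U' -> (#|U'| <= #|U|)%N.
  by case: (arg_maxnP (fun U : {set I} => #|U|) Q0) => U QU Umax; exists U.
have mU : packing_ratio * m U <= C0.
  have [P /and4P[triv _ /eqP <- /forall_inP PB]] := existsP QU.
  rewrite /m finset.big_trivIset// mulr_sumr.
  by apply: le_trans (h_disjoint triv); apply: ler_sum => B /PB.
have mID A : m A = m (A :&: U) + m (A :\: U) by exact: big_setID.
have goodU A : good A -> m (A :\: U) <= 1/2 * m A.
  move=> gA; rewrite leNgt; apply/negP => mB.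
  (* If [B] had more than half of the mass of [A], it could be added to the family, against the
     maximality of [U]. *)
  pose B := A :\: U.
  have BU : [disjoint B & U]%B.
    by rewrite -finset.setI_eq0 finset.setIDAC finset.setDIl finset.setDv finset.setI0.
  have Bn0 : B != finset.set0.
    apply/eqP => B0; move: mB (m0 A); rewrite -/B B0 /m big_set0; lra.
  suff QBU : Q (B :|: U).
    have := Umax _ QBU; rewrite cardsU finset.disjoint_setI0// cards0 subn0.
    by rewrite -[leqRHS]add0n leq_add2r leqn0 cards_eq0 (negbTE Bn0).
  have [P /and4P[triv P0 /eqP cP /forall_inP PB]] := existsP QU.
  have [triv' _] : finset.trivIset (B |: P) /\ B \notin P.
    apply: finset.trivIsetU1 => // D PD; apply: disjointWr BU.
    by rewrite -cP; exact: finset.bigcup_sup.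
  apply/existsP; exists (B |: P); apply/and4P; split => //.
  - by rewrite !inE negb_or eq_sym Bn0.
  - by rewrite /finset.cover finset.bigcup_setU finset.big_set1 -/(finset.cover P) cP.
  apply/forall_inP => D; rewrite !inE => /predU1P[->|/PB//].
  apply: (@le_trans _ _ (packing_ratio * m A)).
    by rewrite ler_pM2l ?packing_ratio_gt0// (mID A) lerDr.
  have sK (t : R) : 0 <= t -> (t `^ s) `^ alpha = t.
    by move=> t0; rewrite -powRrM mulVf ?gt_eqF// powRr1.
  have sK' (t : R) : 0 <= t -> (t `^ alpha) `^ s = t.
    by move=> t0; rewrite -powRrM mulfV ?gt_eqF// powRr1.
  (* After taking roots of order [alpha], [h A] is at least [(3/4 m A)^s] while [h (A :&: U)] is at
     most [(1/2 m A)^s]; subadditivity leaves the difference to [h B]. *)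
  have hA : (3/4) `^ s * m A `^ s <= h A.
    rewrite -powRM ?divr_ge0 ?m0//.
    rewrite -[leRHS]sK'//; apply: ge0_ler_powR; rewrite ?nnegrE ?powR_ge0//.
    - exact: ltW.
    - by apply: mulr_ge0 => //; lra.
  have hAU : h (A :&: U) <= (1/2) `^ s * m A `^ s.
    rewrite -powRM ?divr_ge0 ?m0//.
    rewrite -[leLHS]sK'//; apply: ge0_ler_powR; rewrite ?nnegrE ?powR_ge0//.
    - exact: ltW.
    - by apply: mulr_ge0 => //; lra.
    - by apply: (le_trans (bm _)); have := mID A; move: mB; rewrite -/B; lra.
  have hB : ((3/4) `^ s - (1/2) `^ s) * m A `^ s <= h B.
    by have := hU (A :&: U) B; rewrite finset.setID mulrBl; lra.
  rewrite /packing_ratio -[X in _ * X]sK// -powRM ?powR_ge0//; last exact: ltW.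
  apply: ge0_ler_powR; rewrite ?nnegrE//; first exact: ltW.
  by apply: mulr_ge0; [exact: ltW|exact: powR_ge0].
(* A good set would allow the factor [1/2]; the factor [3/4] comes from the sets that are not good,
   where it holds by definition. *)
have bU A : b A <= 3/4 * m A + m (A :&: U).
  have [/goodU|] := boolP (good A); last first.
    by rewrite -ltNge => /ltW; have := m0 (A :&: U); lra.
  by have := bm A; rewrite mID; have := m0 (A :&: U); lra.
apply: (le_trans (wsum_le bU l0)).
have -> : wsum (fun A => 3/4 * m A + m (A :&: U)) l =
    3/4 * wsum m l + wsum (fun A => m (A :&: U)) l.
  rewrite /wsum mulr_sumr -big_split/=; apply: eq_bigr => i _.
  by rewrite mulrDr mulrCA.
apply: lerD.
  rewrite ler_pM2l; last lra.
  have -> : wsum m l = wsum (fun A => m (A :&: [set: I])) l.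
    by apply: eq_bigr => i _; rewrite finset.setIT.
  by rewrite wsum_mass -mT; apply: ler_sum => x _; rewrite ler_piMr.
rewrite ler_pdivlMr ?packing_ratio_gt0// mulrC; apply: le_trans mU.
rewrite ler_pM2l ?packing_ratio_gt0// wsum_mass.
by apply: ler_sum => x _; rewrite ler_piMr.
Qed.

(** The infimum [K] of all bounds is itself a bound, and improving it gives
    [K <= 3/4 * K + C0 / packing_ratio]. Duality needs a point of [I], so the empty set is treated
    apart. *)
Lemma finite_packing : packing_bound ind b (4 * (C0 / packing_ratio)).
Proof.
have D0 : 0 <= C0 / packing_ratio.
  by rewrite divr_ge0// ltW// packing_ratio_gt0.
have [x0 _|I0] := pickP (@predT I); last first.
  move=> l l0 l1; apply: le_trans (packing_bound_card l0 l1) _.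
  have -> : #|I| = 0%N by apply: eq_card0 => x; have := I0 x.
  by rewrite mulr0; apply: mulr_ge0.
pose S := [set K | 0 <= K /\ packing_bound ind b K].
have S0 : S !=set0.
  by exists (C0 * #|I|%:R); split => //; exact: mulr_ge0.
have lS : has_lbound S by exists 0 => K [].
have infb : packing_bound ind b (inf S).
  by move=> l l0 l1; apply: lb_le_inf => // K [_ Kb]; exact: Kb.
have inf0 : 0 <= inf S by apply: lb_le_inf => // K [].
have : inf S <= 3/4 * inf S + C0 / packing_ratio.
  apply: ge_inf => //; split; last exact: packing_bound_improve.
  by apply: addr_ge0 => //; apply: mulr_ge0 => //; lra.
move=> infS l l0 l1; apply: le_trans (infb l l0 l1) _; lra.
Qed.

End finite_packing.

(** * Functions with prescribed support *)

Section continuous_functions.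
Context (R : realType) (Omega : ptopologicalType).
Implicit Types (f g : continuousType Omega R) (U V F : set Omega).
Local Notation C := (continuousType Omega R).

Lemma cfunDE f g x : (f + g : C) x = f x + g x.
Proof. by []. Qed.

Lemma cfunNE f x : (- f : C) x = - f x.
Proof. by []. Qed.

Lemma cfunZE (k : R) f x : (k *: f : C) x = k * f x.
Proof. by []. Qed.

Lemma cfun0E x : (0 : C) x = 0.
Proof. by []. Qed.

Lemma cfunP f g : (forall x, f x = g x) -> f = g.
Proof. by move=> fg; apply/continuousEP. Qed.

Definition cfun_of (h : Omega -> R) (ch : continuous h) : C := mkcts ch.

Lemma cfun_cst_subproof (c : R) : continuous ((fun=> c) : Omega -> R).
Proof. by move=> x; exact: cvg_cst. Qed.

Definition cfun_cst (c : R) : C := cfun_of (@cfun_cst_subproof c).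

Lemma cfun_mul_subproof f g : continuous ((fun x => f x * g x) : Omega -> R).
Proof. by move=> x; apply: continuousM; exact: cts_fun. Qed.

Definition cfun_mul f g : C := cfun_of (@cfun_mul_subproof f g).

Lemma cfun_clamp_subproof (a b : R) f :
  continuous ((fun x => Num.max a (Num.min b (f x))) : Omega -> R).
Proof.
move=> x; apply: (@continuous_max R Omega (fun=> a)); first exact: cvg_cst.
by apply: (@continuous_min R Omega (fun=> b)); [exact: cvg_cst|exact: cts_fun].
Qed.

Definition cfun_clamp (a b : R) f : C := cfun_of (@cfun_clamp_subproof a b f).

Definition unit_ball : set C := [set f | forall x, `|f x| <= 1].

Lemma supp_closed f : closed (supp f).
Proof. exact: closed_closure. Qed.

Lemma supp_subset f F : closed F -> (forall x, f x != 0 -> F x) ->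
  supp f `<=` F.
Proof.
by move=> cF fF; rewrite ((closure_id _).1 cF); apply: closureS => x /= /fF.
Qed.

Lemma supp_out f x : ~ supp f x -> f x = 0.
Proof.
by move=> fx; apply/eqP/negPn/negP => /= fx0; apply: fx; exact: subset_closure.
Qed.

Lemma supp_in f x : f x != 0 -> supp f x.
Proof. by move=> ?; exact: subset_closure. Qed.

Lemma supp0 : supp (0 : C) = set0.
Proof.
by apply/seteqP; split => // x; apply: supp_subset closed0 _ x => y; rewrite eqxx.
Qed.

Lemma cfun_open_gt f (c : R) : open [set x | c < f x].
Proof.
apply: (@open_comp _ _ f [set y | c < y]) => [x _|]; first exact: cts_fun.
exact: open_gt.
Qed.

Lemma cfun_closed_ge f (c : R) : closed [set x | c <= f x].
Proof.
apply: (@preimage_closed _ _ f [set y | c <= y]) => [x _|]; first exact: cts_fun.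
exact: closed_ge.
Qed.

Hypothesis Omega_compact : compact [set: Omega].
Hypothesis Omega_hausdorff : hausdorff_space Omega.

Lemma urysohn_cfun F U : closed F -> open U -> F `<=` U ->
  exists f : C, [/\ forall x, 0 <= f x <= 1, forall x, F x -> f x = 1 &
    forall x, ~ U x -> f x = 0].
Proof.
move=> cF oU FU.
have nO := compact_normal Omega_hausdorff Omega_compact.
have [|f [cf f01 f0 f1]] := (@uniform_separatorP _ R _ _).1
    ((@normal_separatorP R _).1 nO _ _ (open_closedC oU) cF _).
  by apply/disjoints_subset; exact: subsetC.
exists (cfun_of cf); split => [x|x Fx|x Ux].
- by have /f01 : range f (f x) by exists x.
- by apply: f1; exists x.
- by apply: f0; exists x.
Qed.

(** Let [f] be a Urysohn function. Clamping [3 f - 1] to [[0, 1]] gives the value 1 on the whole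
    neighbourhood [f > 2/3] of [F] and moves the closed support into [f >= 1/3], a closed subset of
    [U]. *)
Lemma bump_cfun F U : closed F -> open U -> F `<=` U ->
  exists u : C, exists W, [/\ open W, F `<=` W, forall x, W x -> u x = 1,
    forall x, 0 <= u x <= 1 & supp u `<=` U].
Proof.
move=> cF oU FU; have [f [f01 f1 f0]] := urysohn_cfun cF oU FU.
pose g : C := 3 *: f - cfun_cst 1.
have uE x : cfun_clamp 0 1 g x = Num.max 0 (Num.min 1 (3 * f x - 1)) by [].
exists (cfun_clamp 0 1 g), [set x | 2/3 < f x]; split.
- exact: cfun_open_gt.
- by move=> x /f1 /= ->; lra.
- move=> x /= fx; rewrite uE /Num.max /Num.min.
  by repeat case: ifP => /=; lra.
- by move=> x; rewrite uE /Num.max /Num.min; repeat case: ifP => /=; lra.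
- apply: (@subset_trans _ [set x | 1/3 <= f x]).
    apply: supp_subset => [|x /=]; first exact: cfun_closed_ge.
    apply: contra_neqT; rewrite -ltNge uE /Num.max /Num.min => fx.
    by repeat case: ifP => /=; lra.
  move=> x /= fx; apply: contrapT => /f0 fx0; move: fx; rewrite fx0; lra.
Qed.

(** A partition of unity with two members: [f] is cut into [f u] and [f (1 - u)], where [u] is a
    bump for [supp f] minus [V] inside [U]. Since [u] is 1 on a neighbourhood [W] of that set, even
    the closed support of [f (1 - u)] stays in [V]. *)
Lemma supp_split f U V : open U -> open V -> supp f `<=` U `|` V ->
  exists f1 f2, [/\ f = f1 + f2, forall x, `|f1 x| <= `|f x|,
    forall x, `|f2 x| <= `|f x|, supp f1 `<=` U & supp f2 `<=` V].
Proof.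
move=> oU oV fUV.
have [||u [W [oW GW W1 u01 uU]]] := @bump_cfun (supp f `\` V) U _ oU.
- by apply: closedI; [exact: supp_closed|exact: open_closedC].
- by move=> x [/fUV[]].
pose f1 := cfun_mul f u.
have f1E x : f1 x = f x * u x by [].
exists f1, (f - f1); split.
- by rewrite addrC subrK.
- move=> x; rewrite f1E normrM ler_piMr//; have := u01 x.
  by move=> /andP[u0 u1]; rewrite ger0_norm.
- move=> x; rewrite cfunDE cfunNE f1E -{1}[f x]mulr1 -mulrBr normrM ler_piMr//.
  by have /andP[u0 u1] := u01 x; rewrite ger0_norm; lra.
- apply: subset_trans uU; apply: supp_subset => [|x]; first exact: supp_closed.
  by rewrite f1E mulf_eq0 negb_or => /andP[_ ux]; exact: supp_in.
- apply: (@subset_trans _ (supp f `&` ~` W)).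
    apply: supp_subset => [|x].
      by apply: closedI; [exact: supp_closed|exact: open_closedC].
    rewrite cfunDE cfunNE f1E => fx; split.
      by apply: supp_in; apply: contra_neq fx => ->; rewrite mul0r subr0.
    by move=> /W1 ux; move: fx; rewrite ux mulr1 subrr eqxx.
  move=> x [fx Wx]; apply: contrapT => Vx; apply: Wx; exact: GW.
Qed.

Lemma closed_cover_bigcup (F : set Omega) (U : nat -> set Omega) :
  closed F -> (forall n, open (U n)) -> F `<=` \bigcup_n U n ->
  exists n, F `<=` \bigcup_(i < n) U i.
Proof.
move=> cF oU FU.
have : compact F by exact: subclosed_compact cF Omega_compact (@subsetT _ F).
rewrite compact_cover => /(_ _ setT U (fun n _ => oU n) FU)[D _ FD].
exists (\max_(i <- finmap.enum_fset D) i).+1 => x /FD[i /= Di Uix]; exists i => //=.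
by rewrite ltnS; exact: (@leq_bigmax_seq _ _ _ (fun i => i)).
Qed.

End continuous_functions.

(** * The set function given by a subadditive functional *)

Section set_function.
Context (R : realType) (Omega : ptopologicalType).
Hypothesis Omega_compact : compact [set: Omega].
Hypothesis Omega_hausdorff : hausdorff_space Omega.
Local Notation C := (continuousType Omega R).
Implicit Types (f g : C) (U V F : set Omega).
Context (L : C -> R) (M : R).
Hypothesis L0 : L 0 = 0.
Hypothesis L_subadd : forall f g, L (f + g) <= L f + L g.
Hypothesis L_bounded : forall f, unit_ball f -> L f <= M.

(** This has two uses: with [L f = ||T f||^r] it is the subadditive set function of the packing
    argument, and with a positive linear functional it is the content of open sets in the Riesz
    construction. *)
Definition sup_on U := sup [set L f | f in [set f | unit_ball f /\ supp f `<=` U]].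

Let ball0 : unit_ball (0 : C).
Proof. by move=> x; rewrite cfun0E normr0. Qed.

Let ne U : [set L f | f in [set f | unit_ball f /\ supp f `<=` U]] !=set0.
Proof. by exists (L 0), 0 => //; rewrite /= supp0; split. Qed.

Let ub U : has_ubound [set L f | f in [set f | unit_ball f /\ supp f `<=` U]].
Proof. by exists M => _ [f [bf _] <-]; exact: L_bounded. Qed.

Lemma le_sup_on U f : unit_ball f -> supp f `<=` U -> L f <= sup_on U.
Proof. by move=> bf fU; apply: ub_le_sup => //; exists f. Qed.

Lemma sup_on_le U (c : R) :
  (forall f, unit_ball f -> supp f `<=` U -> L f <= c) -> sup_on U <= c.
Proof. by move=> Uc; apply: ge_sup => // _ [f [bf fU] <-]; exact: Uc. Qed.

Lemma sup_on_ge0 U : 0 <= sup_on U.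
Proof. by rewrite -L0; apply: le_sup_on; rewrite ?supp0. Qed.

Lemma sup_on_mono U V : U `<=` V -> sup_on U <= sup_on V.
Proof.
by move=> UV; apply: sup_on_le => f bf fU; apply: le_sup_on => // x /fU/UV.
Qed.

Lemma sup_on0 : sup_on set0 = 0.
Proof.
apply/eqP; rewrite eq_le sup_on_ge0 andbT; apply: sup_on_le => f _ f0.
rewrite (_ : f = 0) ?L0//; apply: cfunP => x; apply: supp_out => /f0; exact.
Qed.

Lemma sup_onU U V : open U -> open V ->
  sup_on (U `|` V) <= sup_on U + sup_on V.
Proof.
move=> oU oV; apply: sup_on_le => f bf fUV.
have [f1 [f2 [fE lef1 lef2 f1U f2V]]] :=
  supp_split Omega_compact Omega_hausdorff oU oV fUV.
rewrite fE; apply: (le_trans (L_subadd f1 f2)); apply: lerD; apply: le_sup_on => //.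
- by move=> x; exact: le_trans (lef1 x) (bf x).
- by move=> x; exact: le_trans (lef2 x) (bf x).
Qed.

Lemma sup_on_bigsetU (I : eqType) (s : seq I) (U : I -> set Omega) :
  (forall i, open (U i)) ->
  sup_on (\big[setU/set0]_(i <- s) U i) <= \sum_(i <- s) sup_on (U i).
Proof.
move=> oU; elim: s => [|i s IH]; first by rewrite !big_nil sup_on0.
rewrite !big_cons.
have oB : open (\big[setU/set0]_(j <- s) U j).
  by elim/big_ind : _ => //; [exact: open0|exact: openU].
by apply: le_trans (sup_onU (oU i) oB) _; rewrite lerD2l.
Qed.

End set_function.

Lemma powRD_le (R : realType) (x y k : R) : 0 <= x -> 0 <= y -> 0 <= k ->
  (x + y) `^ k <= 2 `^ k * (x `^ k + y `^ k).
Proof.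
move=> x0 y0 k0.
wlog xy : x y x0 y0 / x <= y.
  move=> H; have [|/ltW yx] := leP x y; first exact: H.
  by rewrite addrC [x `^ k + _]addrC; exact: H.
apply: (@le_trans _ _ ((2 * y) `^ k)).
  by apply: ge0_ler_powR; rewrite ?nnegrE; lra.
rewrite powRM// ler_pM2l ?powR_gt0//.
by rewrite lerDr powR_ge0.
Qed.

(** * Packing bound for supports of functions *)

Section packing.
Context (R : realType) (Omega : ptopologicalType).
Hypothesis Omega_compact : compact [set: Omega].
Hypothesis Omega_hausdorff : hausdorff_space Omega.
Local Notation C := (continuousType Omega R).
Implicit Types (f g : C) (U V F : set Omega).

(** With [u i] equal to 1 on [G i] and to 0 on the other [G j], let [W i] be the set where [u i]
    exceeds the sum of the other [u j]. Two of these strict inequalities exclude each other. *)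
Lemma open_separation (I : finType) (G : I -> set Omega) :
  (forall i, closed (G i)) -> trivIset setT G ->
  exists W : I -> set Omega, [/\ forall i, open (W i),
    forall i, G i `<=` W i & trivIset setT W].
Proof.
move=> cG tG.
have [u uP] : {u : I -> C & forall i, [/\ forall x, 0 <= u i x <= 1,
    forall x, G i x -> u i x = 1 &
    forall x j, j != i -> G j x -> u i x = 0]}.
  apply: (@choice I C (fun i v => [/\ forall x, 0 <= v x <= 1,
    forall x, G i x -> v x = 1 & forall x j, j != i -> G j x -> v x = 0])) => i.
  pose K := \big[setU/set0]_(j <- enum (predC1 i)) G j.
  have [|||v [v01 v1 v0]] :=
      @urysohn_cfun R Omega Omega_compact Omega_hausdorff (G i) (~` K).
  - exact: cG.
  - by apply: closed_openC; apply: closed_bigsetU => j _; exact: cG.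
  - move=> x Gix; rewrite /K -bigcup_seq => -[j /= + Gjx].
    rewrite mem_enum inE => /eqP; apply.
    by apply: tG => //; exists x.
  exists v; split => // x j ji Gjx; apply: v0 => /=; apply.
  by rewrite /K -bigcup_seq; exists j => //=; rewrite mem_enum inE.
pose S i : C := \sum_(j | j != i) u j.
have SE i x : S i x = \sum_(j | j != i) u j x.
  by rewrite /S; elim/big_rec2: _ => // j a b _ <-.
exists (fun i => [set x | 0 < (u i - S i : C) x]); split.
- by move=> i; exact: cfun_open_gt.
- move=> i x Gix /=; have [_ u1 _] := uP i.
  rewrite cfunDE cfunNE SE u1// big1 ?subr0// => j ji.
  by have [_ _] := uP j; apply; [rewrite eq_sym; exact: ji|].
- apply/trivIsetP => i j _ _ ij; apply/seteqP; split => // x [/=].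
  have leS k k' : k != k' -> u k x <= S k' x.
    move=> kk'; rewrite SE (bigD1 k)//= lerDl; apply: sumr_ge0 => m _.
    by have [/(_ x)/andP[]] := uP m.
  rewrite !cfunDE !cfunNE; have := leS i j ij; have := leS j i.
  by rewrite eq_sym => /(_ ij); lra.
Qed.

Context (L : C -> R) (M alpha C0 : R).
Hypothesis alpha_gt0 : 0 < alpha.
Hypothesis L0 : L 0 = 0.
Hypothesis L_ge0 : forall f, 0 <= L f.
Hypothesis L_subadd : forall f g, L (f + g) <= L f + L g.
Hypothesis L_bounded : forall f, unit_ball f -> L f <= M.
Hypothesis L_disjoint : forall n (f : 'I_n -> C),
  (forall i, unit_ball (f i)) -> trivIset setT (fun i => supp (f i)) ->
  \sum_(i < n) L (f i) `^ alpha <= C0.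

Local Notation sup_onL := (sup_on L).

Lemma lt_sup_on U (c : R) : c < sup_onL U ->
  exists f, [/\ unit_ball f, supp f `<=` U & c < L f].
Proof.
move=> cU; apply: contrapT => nf.
suff : sup_onL U <= c by rewrite leNgt cU.
apply: sup_on_le => f bf fU; rewrite leNgt; apply/negP => cf.
by apply: nf; exists f.
Qed.

Let C0_ge0 : 0 <= C0.
Proof.
have := @L_disjoint 0 (fun=> 0); rewrite big_ord0; apply => [[]//|].
by apply/trivIsetP => -[].
Qed.

Lemma sup_on_disjoint n (O : 'I_n -> set Omega) : trivIset setT O ->
  \sum_(i < n) sup_onL (O i) `^ alpha <= C0.
Proof.
move=> tO; set S := \sum_(i < n) _; rewrite leNgt; apply/negP => C0S.
have S0 : 0 < S by exact: le_lt_trans C0S.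
(* [t < 1] is chosen so that [t * S = (C0 + S) / 2] still exceeds [C0]. Functions in the [O i] that
   reach the suprema up to the factor [t^(1/alpha)] then contradict [L_disjoint]. *)
pose t := (C0 / S + 1) / 2.
have CS1 : 0 <= C0 / S < 1 by rewrite divr_ge0 ?(ltW S0)//= ltr_pdivrMr// mul1r.
have t0 : 0 < t by rewrite /t; lra.
have t1 : t < 1 by rewrite /t; lra.
have d1 : t `^ alpha^-1 < 1.
  have := @gt0_ltr_powR R alpha^-1; rewrite invr_gt0 => /(_ alpha_gt0 t 1).
  by rewrite powR1 !nnegrE; apply => //; exact: ltW.
have [f fP] : {f : 'I_n -> C & forall i, [/\ unit_ball (f i),
    supp (f i) `<=` O i & t `^ alpha^-1 * sup_onL (O i) <= L (f i)]}.
  apply: (@choice _ _ (fun i f => [/\ unit_ball f, supp f `<=` O i &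
    t `^ alpha^-1 * sup_onL (O i) <= L f])) => i.
  have /predU1P[<-|s0] : (0 == sup_onL (O i)) || (0 < sup_onL (O i)).
    by rewrite -le_eqVlt; exact: sup_on_ge0 L0 L_bounded _.
    exists 0; split; first by move=> x; rewrite cfun0E normr0.
      by rewrite supp0.
    by rewrite mulr0 L0.
  have [|f [bf fO fs]] := @lt_sup_on (O i) (t `^ alpha^-1 * sup_onL (O i)).
    by rewrite gtr_pMl.
  by exists f; split => //; exact: ltW.
have : t * S <= C0.
  apply: le_trans (L_disjoint (f := f) _ _).
  - rewrite mulr_sumr; apply: ler_sum => i _; have [_ _ fi] := fP i.
    have -> : t = (t `^ alpha^-1) `^ alpha.
      by rewrite -powRrM mulVf ?gt_eqF// powRr1// ltW.
    rewrite -powRM ?powR_ge0// ?(sup_on_ge0 L0 L_bounded)//.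
    apply: ge0_ler_powR; rewrite ?nnegrE//; first exact: ltW.
    by rewrite mulr_ge0 ?powR_ge0// (sup_on_ge0 L0 L_bounded).
  - by move=> i; have [] := fP i.
  - move=> i j _ _ [x [fix_ fjx]]; apply: (tO i j I I); exists x.
    by have [_ fi _] := fP i; have [_ fj _] := fP j; split; [exact: fi|exact: fj].
have -> : t * S = (C0 + S) / 2 by rewrite /t; field; rewrite gt_eqF.
lra.
Qed.

(* [L] is exhaustive: otherwise one could pick arbitrarily many functions with
   disjoint supports in [U] on which [L] is larger than [e]. *)
Lemma sup_on_exhaust U (e : R) : open U -> 0 < e ->
  exists H, [/\ closed H, H `<=` U & sup_onL (U `\` H) <= e].
Proof.
move=> oU e0; apply: contrapT => nH.
have step H : closed H -> H `<=` U ->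
    exists f, [/\ unit_ball f, supp f `<=` U `\` H & e < L f].
  move=> cH HU; apply: lt_sup_on; rewrite ltNge; apply/negP => UH.
  by apply: nH; exists H.
have many n : exists F : nat -> C,
    (forall i, (i < n)%N -> [/\ unit_ball (F i), supp (F i) `<=` U & e < L (F i)])
    /\ forall i j, (i < j < n)%N -> supp (F i) `&` supp (F j) = set0.
  elim: n => [|n [F [FP Fd]]].
    by exists (fun=> 0); split => // i j; rewrite ltn0 andbF.
  (* The supports chosen so far form a closed subset of [U], and the next function is taken off
     it. *)
  pose H := \bigcup_(i < n) supp (F i).
  have [||f [bf fU ef]] := step H.
  - rewrite /H bigcup_mkord; apply: closed_bigsetU => i _; exact: supp_closed.
  - move=> x [i /= /FP[_ FiU _]]; exact: FiU.
  exists (fun i => if (i < n)%N then F i else f); split => [i|i j].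
    case: (ltnP i n) => [/FP//|ni _]; split => //.
    by apply: subset_trans fU _ => x [].
  rewrite ltnS => /andP[ij]; rewrite leq_eqVlt => /predU1P[jn|jn].
    rewrite -jn ij ltnn; apply/seteqP; split => // x [Fx /fU[_]]; apply.
    by exists i => //=; rewrite -jn.
  by rewrite (ltn_trans ij jn) jn; apply: Fd; rewrite ij.
have ea0 : 0 < e `^ alpha by exact: powR_gt0.
pose n := (Num.truncn (C0 / e `^ alpha)).+1.
have nC0 : C0 < n%:R * e `^ alpha.
  by rewrite -ltr_pdivrMr// truncnS_gt.
have [F [FP Fd]] := many n.
suff : n%:R * e `^ alpha <= C0 by rewrite leNgt nC0.
apply: le_trans (L_disjoint (f := fun i : 'I_n => F i) _ _).
- rewrite mulr_natl -[X in _ *+ X]card_ord -sumr_const; apply: ler_sum => i _.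
  have [_ _ /ltW eF] := FP i (ltn_ord i).
  by apply: ge0_ler_powR; rewrite ?nnegrE//; exact: ltW.
- by move=> i; have [] := FP i (ltn_ord i).
- move=> i j _ _ [x [xi xj]]; apply/val_inj.
  have [ij|ji|//] := ltngtP i j; exfalso.
    by rewrite -[False]/(set0 x) -(Fd i j) ?ij ?ltn_ord.
  by rewrite -[False]/(set0 x) -(Fd j i) ?ji ?ltn_ord.
Qed.

Let sup_on_open U V : open U -> open V ->
  sup_onL (U `|` V) <= sup_onL U + sup_onL V.
Proof.
exact: (sup_onU Omega_compact Omega_hausdorff L_subadd L_bounded (U := U)).
Qed.

(** The first summand is the finite packing bound, the summand 1 pays for the exceptional sets, and
    [2 ^ alpha] is the cost of separating the two under the power [alpha]. *)
Definition packing_constant : R :=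
  2 `^ alpha * (4 * (C0 / packing_ratio alpha) + 1).

(** Reduction to the finite case. A point of the finite index set is a set [s] of indices, standing
    for the atom where exactly the supports indexed by [s] are present. Shrunk to closed sets [G s],
    the atoms have disjoint open neighbourhoods [W s], and [h] is [sup_on L] of unions of these. *)
Lemma packing_bound_supp :
  packing_bound (fun (j : {f : C | unit_ball f}) x => \1_(supp (sval j)) x : R)
    (fun j => L (sval j) `^ alpha) packing_constant.
Proof.
move=> l l0 l1.
pose n := size l.
pose c (i : 'I_n) := (tnth (in_tuple l) i).1.
pose g (i : 'I_n) : C := sval (tnth (in_tuple l) i).2.
have wsumE (F : {f : C | unit_ball f} -> R) :
    wsum F l = \sum_(i < n) c i * F (tnth (in_tuple l) i).2.
  by rewrite /wsum big_tnth.
have c0 i : 0 <= c i by exact: (all_tnthP (t := in_tuple l) l0 i).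
have cg1 x : \sum_(i < n) c i * \1_(supp (g i)) x <= 1.
  by have := l1 x; rewrite wsumE.
rewrite wsumE -/c; under eq_bigr do rewrite -/(g _).
pose Sc := \sum_(i < n) c i.
have Sc0 : 0 <= Sc by exact: sumr_ge0.
(* [t] is the error allowed in each [L (g i)]; the choice makes the total error [sum_i c_i t^alpha]
   at most 1. *)
pose t := (1 + Sc)^-1 `^ alpha^-1.
have t0 : 0 < t by rewrite powR_gt0// invr_gt0; lra.
have tSc : t `^ alpha * Sc <= 1.
  rewrite -powRrM mulVf ?gt_eqF// powRr1 ?invr_ge0; last by lra.
  by rewrite mulrC ler_pdivrMr; lra.
(* There are [n] exceptional sets of size at most [eta]; dividing by [n + 1] avoids a division by
   zero. *)
pose eta := t / n.+1%:R.
have eta0 : 0 < eta by exact: divr_gt0.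
have [H HP] : {H : 'I_n -> set Omega & forall i, [/\ closed (H i),
    H i `<=` ~` supp (g i) & sup_onL (~` supp (g i) `\` H i) <= eta]}.
  apply: (@choice _ _ (fun i H => [/\ closed H, H `<=` ~` supp (g i) &
    sup_onL (~` supp (g i) `\` H) <= eta])) => i.
  by apply: sup_on_exhaust => //; apply: closed_openC; exact: supp_closed.
(* The atoms of the algebra generated by the supports, shrunk to closed sets. *)
pose G (s : {set 'I_n}) := \bigcap_i (if i \in s then supp (g i) else H i).
have cG s : closed (G s).
  apply: closed_bigI => i _; case: ifP => _; first exact: supp_closed.
  by have [] := HP i.
have tG : trivIset setT G.
  move=> s s' _ _ [x [sx s'x]]; apply/setP => i.
  have [_ HS _] := HP i; have := sx i I; have := s'x i I.
  by do 2 case: (i \in _) => //; [move=> /HS|move=> + /HS].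
have [W [oW GW tW]] := open_separation cG tG.
pose h (A : {set {set 'I_n}}) := sup_onL (\bigcup_(s in [set` A]) W s).
have oh (A : {set {set 'I_n}}) : open (\bigcup_(s in [set` A]) W s).
  by apply: bigcup_open => s _; exact: oW.
have fin : packing_bound (fun (A : {set {set 'I_n}}) s => (s \in A)%:R)
    (fun A => h A `^ alpha) (4 * (C0 / packing_ratio alpha)).
  apply: finite_packing => //.
  - by move=> A; exact: sup_on_ge0 L0 L_bounded _.
  - rewrite /h (_ : \bigcup_(s in _) _ = set0); last first.
      by apply/seteqP; split => // x [s /=]; rewrite finset.inE.
    exact: sup_on0 L0 L_bounded.
  - move=> A B; apply: le_trans (sup_on_open (oh A) (oh B)) => //.
    rewrite /h (_ : \bigcup_(s in _) _ =
      \bigcup_(s in [set` A]) W s `|` \bigcup_(s in [set` B]) W s)//.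
    rewrite -bigcup_setU; apply: eq_bigcupl.
    by split => s /=; rewrite finset.inE => /orP.
  - move=> P /finset.trivIsetP tP; rewrite big_enum_val/=.
    pose O (i : 'I_#|P|) := \bigcup_(s in [set` (enum_val i : {set {set 'I_n}})]) W s.
    apply: (@sup_on_disjoint _ O).
    move=> i j _ _ [x [[s /= si sx] [s' /= s'j s'x]]].
    have ss' : s = s' by apply: tW => //; exists x.
    apply: enum_val_inj; apply/eqP; apply: contraT => ij.
    have := tP _ _ (enum_valP i) (enum_valP j) ij.
    by move=> /pred0P/(_ s)/=; rewrite si ss' s'j.
(* Only nonempty atoms are kept: a point [x] of [G s] is where the packing condition on the supports
   is evaluated to give the one at [s]. *)
pose A i : {set {set 'I_n}} := [set s : {set 'I_n} | (i \in s) && `[< G s !=set0 >]]%SET.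
pose lA := [seq (c i, A i) | i <- enum 'I_n].
have wsumA (F : {set {set 'I_n}} -> R) : wsum F lA = \sum_(i < n) c i * F (A i).
  by rewrite /wsum big_map big_enum.
have lA0 : nneg_weights lA by rewrite /nneg_weights all_map; apply/allP => i _ /=.
have {fin} : \sum_(i < n) c i * h (A i) `^ alpha <= 4 * (C0 / packing_ratio alpha).
  have := fin lA lA0; rewrite wsumA; apply => s; rewrite wsumA.
  have [[x Gx]|G0] := pselect (G s !=set0); last first.
    rewrite big1// => i _; rewrite finset.inE.
    by case: asboolP => //; rewrite andbF mulr0.
  apply: le_trans (cg1 x); apply: ler_sum => i _; apply: ler_wpM2l => //.
  rewrite finset.inE indicE; case: (boolP (i \in s)) => //= si.
  rewrite (mem_set (_ : supp (g i) x)); first by case: asboolP.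
  by have := Gx i I; rewrite si.
pose U0 := \big[setU/set0]_(j < n) (~` supp (g j) `\` H j).
have oD j : open (~` supp (g j) `\` H j).
  have [cH _ _] := HP j; apply: openI; last exact: closed_openC.
  by apply: closed_openC; exact: supp_closed.
have oU0 : open U0 by rewrite /U0; elim/big_ind : _ => //; [exact: open0|exact: openU].
have U0t : sup_onL U0 <= t.
  apply: le_trans (sup_on_bigsetU Omega_compact Omega_hausdorff L0 L_subadd
    L_bounded _ oD) _ => //.
  apply: (@le_trans _ _ (\sum_(j < n) eta)).
    by apply: ler_sum => j _; have [] := HP j.
  rewrite sumr_const card_ord -mulr_natr /eta mulrAC ler_pdivrMr// ler_pM2l//.
  by rewrite ler_nat.
(* Outside [U0], a point [x] lies in [G s] for [s] the set of all [j] with [x] in [supp (g j)].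
   Hence [supp (g i)] is covered by [U0] and the [W s] with [s] in [A i]. *)
have Lg i : L (g i) <= h (A i) + t.
  apply: (@le_trans _ _ (sup_onL (\bigcup_(s in [set` A i]) W s `|` U0))).
    apply: (le_sup_on L_bounded); first exact: svalP.
    move=> x gx; have [Ux|Ux] := pselect (U0 x); [by right|left].
    have Hx j : ~ supp (g j) x -> H j x.
      move=> gjx; apply: contrapT => Hjx; apply: Ux.
      rewrite /U0 (bigD1 j)//=; left; split => //.
    pose s := [set j | `[< supp (g j) x >]]%SET.
    have Gsx : G s x.
      by move=> j _; rewrite finset.inE; case: asboolP => // /Hx.
    exists s; last exact: GW.
    rewrite /= !finset.inE; apply/andP; split; first exact/asboolP.
    by apply/asboolP; exists x.
  apply: le_trans (sup_on_open (oh _) oU0) _ => //.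
  by rewrite lerD2l.
have h_ge0 B : 0 <= h B by exact: sup_on_ge0 L0 L_bounded _.
move=> fin.
apply: (@le_trans _ _ (2 `^ alpha * (\sum_(i < n) c i * h (A i) `^ alpha +
    t `^ alpha * Sc))); last first.
  by rewrite ler_pM2l ?powR_gt0//; lra.
rewrite /Sc mulr_sumr -big_split mulr_sumr/=; apply: ler_sum => i _.
rewrite [t `^ alpha * _]mulrC -mulrDr mulrCA; apply: ler_wpM2l => //.
apply: le_trans (powRD_le _ (ltW t0) (ltW alpha_gt0)) => //.
by apply: ge0_ler_powR; rewrite ?nnegrE ?addr_ge0 ?(ltW t0)// ltW.
Qed.

End packing.

Lemma measure_probability d (X : measurableType d) (R : realType)
    (m : {measure set X -> \bar R}) : m setT = 1%E ->
  exists mu : probability X R, forall A, mu A = m A.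
Proof.
move=> m1; exists (mnormalize m \d_point) => A.
change (mnormalize m \d_point A = m A); rewrite /mnormalize m1 ifF.
  by rewrite (_ : (fine 1)^-1 = 1 :> R) ?mule1 ?invr1.
by rewrite orbF; apply/negP; rewrite eqe oner_eq0.
Qed.

(** * The measure of a positive functional *)

Section riesz_measure.
Context (R : realType) (Omega : ptopologicalType).
Hypothesis Omega_compact : compact [set: Omega].
Hypothesis Omega_hausdorff : hausdorff_space Omega.
Local Notation C := (continuousType Omega R).
Implicit Types (f g : C) (U V F A : set Omega).
Context (T : {linear C -> R^o}).
Hypothesis T1 : T (cfun_cst Omega 1) = 1.
Hypothesis T_ge0 : forall f, (forall x, 0 <= f x) -> 0 <= T f.

Local Notation content := (sup_on (T : C -> R)).

Let T0 : (T : C -> R) 0 = 0. Proof. exact: linear0. Qed.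

Let TD f g : T (f + g) = T f + T g. Proof. exact: linearD. Qed.

Let T_subadd f g : (T : C -> R) (f + g) <= T f + T g.
Proof. by rewrite TD. Qed.

Lemma positive_mono f g : (forall x, f x <= g x) -> T f <= T g.
Proof.
move=> fg; rewrite -subr_ge0.
have -> : T g - T f = T (g - f) by rewrite linearB.
by apply: T_ge0 => x; rewrite cfunDE cfunNE subr_ge0.
Qed.

Let T_bounded f : unit_ball f -> (T : C -> R) f <= 1.
Proof.
move=> bf; rewrite -T1; apply: positive_mono => x.
exact: le_trans (ler_norm _) (bf x).
Qed.

Let content_ge0 U : 0 <= content U.
Proof. exact: sup_on_ge0 T0 T_bounded U. Qed.

Let content_mono U V : U `<=` V -> content U <= content V.
Proof. by move=> UV; apply: (sup_on_mono T_bounded). Qed.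

Lemma contentT : content setT = 1.
Proof.
apply/eqP; rewrite eq_le; apply/andP; split.
  by apply: sup_on_le => f bf _; exact: T_bounded.
rewrite -{1}T1; apply: (le_sup_on T_bounded) => // x.
by rewrite /= normr1.
Qed.

Definition outer_content A : R := inf [set content U | U in [set U | open U /\ A `<=` U]].

Let outer_ne A : [set content U | U in [set U | open U /\ A `<=` U]] !=set0.
Proof. by exists (content setT), setT => //; split => //; exact: openT. Qed.

Let outer_lb A : has_lbound [set content U | U in [set U | open U /\ A `<=` U]].
Proof. by exists 0 => _ [U _ <-]. Qed.

Lemma outer_content_le A U : open U -> A `<=` U -> outer_content A <= content U.
Proof. by move=> oU AU; apply: ge_inf => //; exists U. Qed.

Lemma le_outer_content A (c : R) :
  (forall U, open U -> A `<=` U -> c <= content U) -> c <= outer_content A.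
Proof. by move=> Ac; apply: lb_le_inf => // _ [U [oU AU] <-]; exact: Ac. Qed.

Lemma outer_content_ge0 A : 0 <= outer_content A.
Proof. exact: le_outer_content. Qed.

Lemma outer_content_mono A B : A `<=` B -> outer_content A <= outer_content B.
Proof.
move=> AB; apply: le_outer_content => U oU BU.
by apply: outer_content_le => // x /AB/BU.
Qed.

Lemma outer_content_near A (e : R) : 0 < e ->
  exists U, [/\ open U, A `<=` U & content U <= outer_content A + e].
Proof.
move=> e0; apply: contrapT => nU.
suff : outer_content A + e <= outer_content A by lra.
apply: le_outer_content => U oU AU; apply/ltW; rewrite ltNge; apply/negP => le.
by apply: nU; exists U.
Qed.

(** The support of a competitor [f] is compact, so finitely many [U n] cover it and finite
    subadditivity applies. *)
Lemma content_sigma_subadd (U : nat -> set Omega) : (forall n, open (U n)) ->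
  ((content (\bigcup_n U n))%:E <= \sum_(n <oo) (content (U n))%:E)%E.
Proof.
move=> oU; set S := (\sum_(n <oo) _)%E.
suff : forall f, unit_ball f -> supp f `<=` \bigcup_n U n -> ((T f)%:E <= S)%E.
  have S0 : (0 <= S)%E by apply: nneseries_ge0 => n _ _; rewrite lee_fin.
  case: S S0 => [s _ fs|_ _|//]; last by rewrite leey.
  by rewrite lee_fin; apply: sup_on_le => f bf /(fs f bf); rewrite lee_fin.
move=> f bf fU.
have [n fUn] := closed_cover_bigcup Omega_compact (@supp_closed _ _ f) oU fU.
have le1 : T f <= \sum_(0 <= i < n) content (U i).
  apply: (@le_trans _ _ (content (\big[setU/set0]_(i <- index_iota 0 n) U i))).
    apply: (le_sup_on T_bounded) => //.
    by rewrite big_mkord -bigcup_mkord.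
  exact: (sup_on_bigsetU Omega_compact Omega_hausdorff T0 T_subadd T_bounded).
apply: (@le_trans _ _ (\sum_(0 <= i < n) (content (U i))%:E)%E).
  by rewrite sumEFin lee_fin.
by apply: nneseries_lim_ge => i _ _; rewrite lee_fin.
Qed.

Let om A : \bar R := (outer_content A)%:E.

Let om0 : om set0 = 0%E.
Proof.
rewrite /om; congr (_%:E); apply/eqP; rewrite eq_le outer_content_ge0 andbT.
rewrite -(sup_on0 T0 T_bounded); apply: outer_content_le => //; exact: open0.
Qed.

Let om_ge0 A : (0 <= om A)%E.
Proof. by rewrite lee_fin outer_content_ge0. Qed.

Let om_mono A B : A `<=` B -> (om A <= om B)%E.
Proof. by move=> AB; rewrite lee_fin outer_content_mono. Qed.

Let om_sigma_subadd : sigma_subadditive om.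
Proof.
move=> F; apply/lee_addgt0Pr => /= e e0.
have [U UP] : {U : nat -> set Omega & forall n, [/\ open (U n), F n `<=` U n &
    content (U n) <= outer_content (F n) + e / (2 ^ n.+1)%:R]}.
  apply: (@choice _ _ (fun n U => [/\ open U, F n `<=` U &
    content U <= outer_content (F n) + e / (2 ^ n.+1)%:R])) => n.
  by apply: outer_content_near; rewrite divr_gt0// ltr0n expn_gt0.
have oU n : open (U n) by have [] := UP n.
have FU : \bigcup_n F n `<=` \bigcup_n U n.
  by apply: subset_bigcup => n _; have [] := UP n.
apply: (@le_trans _ _ (content (\bigcup_n U n))%:E).
  by rewrite lee_fin; apply: outer_content_le => //; exact: bigcup_open.
move/le_trans: (content_sigma_subadd oU); apply.
apply: le_trans (epsilon_trick xpredT (fun n => om_ge0 (F n)) (ltW e0)).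
apply: lee_nneseries => [n _ _|n _]; first by rewrite lee_fin.
by rewrite -EFinD lee_fin; have [] := UP n.
Qed.

Let om_outer := isOuterMeasure.Build R Omega om om0 om_ge0 om_mono om_sigma_subadd.
Let mu_outer : {outer_measure set Omega -> \bar R} := HB.pack om om_outer.

(** The Caratheodory inequality for an open [U]. For [V] open around [A], take [f] supported in [V]
    and [U], then [g] supported in [V] minus [supp f]. Disjointness of supports keeps [f + g] in the
    unit ball, so [T f + T g <= content V]; suprema over [g] and then over [f] give the claim. *)
Lemma open_outer_content A U : open U ->
  outer_content (A `&` U) + outer_content (A `&` ~` U) <= outer_content A.
Proof.
move=> oU; apply: le_outer_content => V oV AV.
suff : content (V `&` U) + outer_content (A `\` U) <= content V.
  apply: le_trans; rewrite lerD2r; apply: outer_content_le; first exact: openI.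
  by move=> x [/AV].
rewrite -lerBrDr; apply: sup_on_le => f bf fVU.
rewrite lerBrDr -lerBrDl.
apply: (@le_trans _ _ (content (V `\` supp f))).
  apply: outer_content_le.
    by apply: openI => //; apply: closed_openC; exact: supp_closed.
  by move=> x [/AV Vx Ux]; split => // /fVU[].
apply: sup_on_le => g bg gVf; rewrite lerBrDl -TD.
apply: (le_sup_on T_bounded) => [x|].
  have [fx|/supp_out fx] := pselect (supp f x).
    rewrite cfunDE (supp_out (f := g)) ?addr0//.
    by move=> /gVf[].
  by rewrite cfunDE fx add0r.
apply: (@subset_trans _ (supp f `|` supp g)).
  apply: supp_subset => [|x]; first by apply: closedU; exact: supp_closed.
  rewrite cfunDE; have [->|/supp_in] := eqVneq (f x) 0; last by left.
  by rewrite add0r => /supp_in; right.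
by move=> x [/fVU[]|/gVf[]].
Qed.

Lemma borel_caratheodory (A : set (borel Omega)) : measurable A ->
  mu_outer.-caratheodory A.
Proof.
move: A; apply: smallest_sub.
  split.
  - exact: caratheodory_measurable_set0.
  - by move=> A mA; rewrite setTD; exact: caratheodory_measurable_setC.
  - exact: caratheodory_measurable_bigcup.
move=> U oU; apply: le_caratheodory_measurable => X.
by rewrite /= /om -EFinD lee_fin; exact: open_outer_content.
Qed.

(** The measure is the outer content on Borel sets. Each open [U] around [F] carries a bump [u]
    equal to 1 on [F] with support in [U], so [c <= T u <= content U]; then the infimum over [U] is
    taken. *)
Lemma riesz_measure : exists mu : probability (borel Omega) R,
  forall F (c : R), closed F ->
    (forall u : C, (forall x, 0 <= u x) -> (forall x, F x -> 1 <= u x) ->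
       c <= T u) ->
    (c%:E <= mu F)%E.
Proof.
pose m0 : set (borel Omega) -> \bar R := om.
have m_add : semi_sigma_additive m0.
  move=> A mA tA mbA.
  apply: (caratheodory_measure_sigma_additive (mu := mu_outer)) => //.
    by move=> n; exact: borel_caratheodory.
  exact: borel_caratheodory.
pose mB := isMeasure.Build _ (borel Omega) R m0 om0 om_ge0 m_add.
have m1 : m0 setT = 1%E.
  congr (_%:E); apply/eqP; rewrite eq_le; apply/andP; split.
    by rewrite -contentT; apply: outer_content_le => //; exact: openT.
  apply: le_outer_content => U oU TU.
  by rewrite -contentT; exact: content_mono.
pose m : {measure set (borel Omega) -> \bar R} := HB.pack m0 mB.
have [mu muE] := @measure_probability _ _ _ m m1.
exists mu => F c cF Fc.
rewrite muE /= /m0 /om lee_fin; apply: le_outer_content => U oU FU.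
have [u [W [_ FW W1 u01 uU]]] :=
  bump_cfun R Omega_compact Omega_hausdorff cF oU FU.
apply: le_trans (Fc u _ _) _.
- by move=> x; have /andP[] := u01 x.
- by move=> x /FW /W1 ->.
- apply: (le_sup_on T_bounded) => // x.
  by have /andP[u0 u1] := u01 x; rewrite ger0_norm.
Qed.

End riesz_measure.

(** * Lorentz quasi-norms *)

Section nonneg_integral.
Local Open Scope ereal_scope.

(* Unlike [ge0_le_integral], no measurability is needed. *)
Lemma integral_ge0_mono d (X : measurableType d) (R : realType)
    (mu : {measure set X -> \bar R}) (D : set X) (f g : X -> \bar R) :
  (forall x, D x -> 0 <= f x) -> (forall x, D x -> f x <= g x) ->
  \int[mu]_(x in D) f x <= \int[mu]_(x in D) g x.
Proof.
move=> f0 fg; rewrite !ge0_integralE//; last first.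
  by move=> x Dx; exact: le_trans (f0 x Dx) (fg x Dx).
apply: ge_ereal_sup => _ [h hf <-]; apply: ereal_sup_ubound; exists h => // x.
apply: le_trans (hf x) _; rewrite !patchE; case: ifPn => // /set_mem; exact: fg.
Qed.

End nonneg_integral.

(** * Integrals of the power weight *)

Section power_weight.
Context (R : realType) (b : R).
Hypothesis b_gt0 : 0 < b.
Local Notation mu := (@lebesgue_measure R).

Let w (t : R) : R := b * t `^ (b - 1).

Let w_meas : measurable_fun setT w.
Proof. by apply: measurable_funM => //; exact: measurable_powR. Qed.

Let w_ge0 t : 0 <= w t.
Proof. by rewrite mulr_ge0 ?powR_ge0// ltW. Qed.

Let integral_weight_itv (a m : R) : 0 < a -> a < m ->
  (\int[mu]_(t in `[a, m]) (w t)%:E = (m `^ b - a `^ b)%:E)%E.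
Proof.
move=> a0 am; rewrite (@continuous_FTC2 _ w (fun x => x `^ b)) ?EFinB//.
- apply: continuous_in_subspaceT => x /set_mem/=; rewrite in_itv/= => /andP[ax _].
  have x0 : 0 < x by exact: lt_le_trans ax.
  apply: (@continuousM _ _ (fun=> b) (fun t : R => t `^ (b - 1))).
    exact: cvg_cst.
  apply: differentiable_continuous; apply/derivable1_diffP.
  by apply: derivable_powR; rewrite in_itv/= x0.
- have dpow x : 0 < x -> derivable (fun x : R => x `^ b) x 1.
    by move=> x0; apply: derivable_powR; rewrite in_itv/= x0.
  have cpow x : 0 < x -> {for x, continuous (fun x : R => x `^ b)}.
    by move=> x0; apply: differentiable_continuous; apply/derivable1_diffP/dpow.
  split.
  + by move=> x; rewrite in_itv/= => /andP[ax _]; apply: dpow; exact: lt_trans ax.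
  + by apply: cvg_at_right_filter; exact: cpow.
  + by apply: cvg_at_left_filter; apply: cpow; exact: lt_trans am.
- move=> x; rewrite in_itv/= => /andP[ax _].
  by rewrite powR_derive1// in_itv/= (lt_trans a0 ax).
Qed.

(** For [b < 1] the weight is unbounded at 0, so the fundamental theorem of calculus is used on
    [[a n, m]], followed by monotone convergence as [a n] decreases to 0. *)
Let integral_weight0 (m : R) : 0 < m ->
  (\int[mu]_(t in `]0%R, m]) (w t)%:E = (m `^ b)%:E)%E.
Proof.
move=> m0.
have mb0 : 0 < m `^ b by exact: powR_gt0.
(* That is, [(a n)^b = m^b / (n + 2)]; the index shift makes already [a 0] smaller than [m]. *)
pose a n := (m `^ b * (harmonic n.+1 : R)) `^ b^-1.
have h0 n : 0 < (harmonic n : R) by rewrite invr_gt0 ltr0n.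
have ab n : a n `^ b = m `^ b * harmonic n.+1.
  rewrite -powRrM mulVf ?gt_eqF// powRr1// mulr_ge0// ltW//; exact: h0.
have a0 n : 0 < a n by rewrite powR_gt0// mulr_gt0//; exact: h0.
have leb x y : 0 <= x -> 0 <= y -> x `^ b <= y `^ b -> x <= y.
  move=> x0 y0; apply: contraTT; rewrite -!ltNge => yx.
  by apply: gt0_ltr_powR; rewrite ?nnegrE.
have leb' x y : 0 <= x -> 0 <= y -> x <= y -> x `^ b <= y `^ b.
  by move=> x0 y0; apply: ge0_ler_powR; rewrite ?nnegrE// ltW.
have am n : a n < m.
  rewrite ltNge; apply/negP => /(leb' _ _ (ltW m0) (ltW (a0 n))).
  rewrite ab; apply/negP; rewrite -ltNge gtr_pMr// invf_lt1 ?ltr0n//.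
  by rewrite ltr1n.
have anti n k : (n <= k)%N -> a k <= a n.
  move=> nk; apply: leb; [exact: ltW|exact: ltW|rewrite !ab ler_pM2l//].
  by rewrite lef_pV2 ?posrE ?ltr0n// ler_nat.
pose F n := `[a n, m]%classic.
have -> : `]0%R, m]%classic = \bigcup_n F n.
  apply/seteqP; split => x /=.
    rewrite in_itv/= => /andP[x0 xm].
    pose n := Num.truncn (m `^ b / x `^ b).
    have xb : 0 < x `^ b by exact: powR_gt0.
    exists n => //; rewrite /F /= in_itv/= xm andbT.
    apply: leb; [exact: ltW|exact: ltW|rewrite ab].
    rewrite ler_pdivrMr ?ltr0n// mulrC -ler_pdivrMr//.
    by apply: ltW; apply: lt_le_trans (truncnS_gt _) _; rewrite ler_nat.
  move=> [n _]; rewrite /F /= !in_itv/= => /andP[ax ->]; rewrite andbT.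
  exact: lt_le_trans ax.
have cvg1 : (\int[mu]_(t in F n) (w t)%:E)%E @[n --> \oo] -->
    (\int[mu]_(t in \bigcup_n F n) (w t)%:E)%E.
  apply: ge0_nondecreasing_set_cvg_integral.
  - move=> n k nk; apply/subsetPset => x; rewrite /F /= !in_itv/=.
    by move=> /andP[ax ->]; rewrite andbT; exact: le_trans (anti _ _ nk) ax.
  - by move=> n; exact: measurable_itv.
  - by move=> n; apply: measurable_funTS; exact/measurable_EFinP.
  - by move=> n x _; rewrite lee_fin.
have cvg2 : (\int[mu]_(t in F n) (w t)%:E)%E @[n --> \oo] --> (m `^ b)%:E.
  rewrite (_ : (fun n => _) =
      (fun n => (m `^ b - m `^ b * harmonic n.+1)%:E)); last first.
    by apply/funext => n; rewrite integral_weight_itv// ab.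
  apply: cvg_EFin; first by near=> n.
  rewrite -[X in _ --> X]subr0; apply: cvgB; first exact: cvg_cst.
  rewrite -(mulr0 (m `^ b)); apply: cvgM; first exact: cvg_cst.
  by rewrite (cvg_shiftS (harmonic : nat -> R)); exact: cvg_harmonic.
exact: (cvg_unique _ cvg1 cvg2).
Unshelve. all: by end_near. Qed.

(** The cut at [m] sits in the integrand, so that weights with different cuts can be added under one
    integral. *)
Lemma integral_power_weight (m : R) : 0 <= m ->
  (\int[mu]_(t in `]0%R, +oo[) (((EFin \o w) \_ `]-oo, m[%classic) t) =
   (m `^ b)%:E)%E.
Proof.
move=> m0; rewrite -integral_mkcondr.
have -> : `]0%R, +oo[%classic `&` `]-oo, m[%classic = `]0%R, m[%classic :> set R.
  by apply/seteqP; split => x /=; rewrite !in_itv/= ?andbT => /andP.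
have wm D : measurable_fun D (EFin \o w).
  by apply: measurable_funTS; exact/measurable_EFinP.
rewrite integral_itv_bndo_bndc//.
move: m0; rewrite le_eqVlt => /predU1P[<-|/integral_weight0//].
by rewrite set_itvoc0 ?integral_set0 ?powR0 ?gt_eqF.
Qed.

End power_weight.

Lemma powR2N_lt1 (R : realType) (r : R) : 0 < r -> 2 `^ (- r) < 1 :> R.
Proof.
move=> r0; rewrite powRN invf_lt1 ?powR_gt0//.
have := @gt0_ltr_powR R r r0 1 2; rewrite powR1 !nnegrE; apply => //.
by rewrite ltr1n.
Qed.

Lemma geometric_level_sum (R : realType) (r s y : R) n :
  0 < r -> 0 <= s -> 0 <= y ->
  \sum_(k < n | s / 2 ^+ k <= y) (s / 2 ^+ k) `^ r <= y `^ r / (1 - 2 `^ (- r)).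
Proof.
move=> r0 s0 y0.
have rho1 : 0 < 1 - 2 `^ (- r) :> R.
  by rewrite subr_gt0 powR2N_lt1.
rewrite ler_pdivlMr//.
have sk0 k : 0 <= s / 2 ^+ k by rewrite divr_ge0// exprn_ge0.
pose u k := Num.min (s / 2 ^+ k) y.
have u0 k : 0 <= u k by rewrite le_min sk0.
(* The selected terms form a geometric progression starting at most at [y^r]. Carrying the remainder
   [(u n)^r] makes the induction telescope. *)
suff : (\sum_(k < n | s / 2 ^+ k <= y) (s / 2 ^+ k) `^ r) * (1 - 2 `^ (- r)) +
    u n `^ r <= y `^ r by apply: le_trans; rewrite lerDl powR_ge0.
elim: n => [|n IH].
  rewrite big_ord0 mul0r add0r; apply: ge0_ler_powR; rewrite ?nnegrE ?(ltW r0)//.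
  by rewrite ge_min lexx orbT.
apply: le_trans IH.
have sS : s / 2 ^+ n.+1 = s / 2 ^+ n * 2^-1 by rewrite exprSr invfM mulrA.
have sle : s / 2 ^+ n.+1 <= s / 2 ^+ n by rewrite sS ler_piMr// invf_le1// ler1n.
rewrite big_mkcond/= big_ord_recr/= -big_mkcond/=.
case: ifPn => sy.
  rewrite mulrDl -addrA lerD2l /u (min_idPl (le_trans sle sy)) (min_idPl sy).
  rewrite sS (@powRM _ _ 2^-1 r (sk0 n)) ?invr_ge0//.
  have -> : (2^-1 : R) `^ r = 2 `^ (- r) by rewrite -powR_inv1// -powRrM mulN1r.
  by lra.
rewrite addr0 lerD2l; apply: ge0_ler_powR; rewrite ?nnegrE ?(ltW r0)//.
by rewrite le_min !ge_min sle lexx orbT.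
Qed.

(** * Upper and lower bounds for Lorentz quasi-norms *)

Section rearrangement.
Local Open Scope ereal_scope.
Context d (X : measurableType d) (R : realType).
Context (mu : {measure set X -> \bar R}) (f : X -> R).

Lemma rearrangement_ge0 t : 0 <= rearrangement mu f t.
Proof.
by apply: le_ereal_inf_tmp => _ [E _ <-]; apply: ereal_sup_ubound; left.
Qed.

Lemma le_rearrangement (A : set X) (c t : R) : measurable A ->
  (forall x, A x -> (c <= `|f x|)%R) -> t%:E < mu A ->
  c%:E <= rearrangement mu f t.
Proof.
move=> mA Ac tA; apply: le_ereal_inf_tmp => _ [E [mE Et] <-].
have [x [Ax Ex]] : exists x, A x /\ ~ E x.
  apply: contrapT => nx; suff : mu A <= t%:E by rewrite leNgt tA.
  apply: le_trans Et; apply: le_measure; rewrite ?inE// => x Ax.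
  by apply: contrapT => Ex; apply: nx; exists x.
apply: (@le_trans _ _ (`|f x|%:E)); first by rewrite lee_fin Ac.
by apply: ereal_sup_ubound; right; exists x.
Qed.

Lemma rearrangement_le (E : set X) (c t : R) : measurable E -> mu E <= t%:E ->
  (0 <= c)%R -> (forall x, ~ E x -> (`|f x| <= c)%R) ->
  rearrangement mu f t <= c%:E.
Proof.
move=> mE Et c0 Ec.
apply: (@le_trans _ _ (ereal_sup (0 |` [set `|f x|%:E | x in ~` E]))).
  by apply: ereal_inf_lbound; exists E.
apply: ge_ereal_sup => _ [->|[x Ex <-]]; first by rewrite lee_fin.
by rewrite lee_fin; exact: Ec.
Qed.

Context (q r s : R).
Hypotheses (q_gt0 : (0 < q)%R) (r_gt0 : (0 < r)%R).
Hypothesis f_le : forall x, (`|f x| <= s)%R.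

Let s_ge0 : (0 <= s)%R.
Proof. exact: le_trans (normr_ge0 _) (f_le point). Qed.

Let rq_gt0 : (0 < r / q)%R. Proof. exact: divr_gt0. Qed.

Let w (t : R) : R := (r / q * t `^ (r / q - 1))%R.

Let w_ge0 t : (0 <= w t)%R.
Proof. by rewrite mulr_ge0 ?powR_ge0// ltW. Qed.

Let w_meas D : measurable_fun D (EFin \o w).
Proof.
apply: measurable_funTS; apply/measurable_EFinP.
by apply: measurable_funM => //; exact: measurable_powR.
Qed.

Let cut m := (EFin \o w) \_ `]-oo, m[%classic.

Let cut_ge0 m t : 0 <= cut m t.
Proof. by rewrite /cut patchE; case: ifP => //= _; rewrite lee_fin. Qed.

Let cut_meas (D : set R) m : measurable D -> measurable_fun D (cut m).
Proof.
move=> mD; apply: measurable_funTS.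
by apply/(measurable_restrictT _ _).1 => //; exact: measurable_itv.
Qed.

(** The rearrangement is at most [s] everywhere and vanishes from [m] on, so the integral is at most
    [s^r m^(r/q)]. *)
Lemma lorentz_norm_le (E : set X) (m : R) : measurable E -> mu E <= m%:E ->
  (forall x, ~ E x -> f x = 0%R) ->
  lorentz_norm q r mu f <= (s * m `^ q^-1)%:E.
Proof.
move=> mE Em fE.
have m0 : (0 <= m)%R by rewrite -lee_fin; apply: le_trans Em.
pose I := \int[lebesgue_measure]_(t in `]0%R, +oo[)
     ((r / q * t `^ (r / q - 1))%:E * rearrangement mu f t `^ r).
have : I <= ((s `^ r)%R)%:E * (m `^ (r / q))%:E.
  rewrite -(integral_power_weight rq_gt0 m0) -ge0_integralZl//.
  - apply: integral_ge0_mono => [t|t]; rewrite /= in_itv/= andbT => t0.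
      by rewrite mule_ge0 ?lee_fin ?w_ge0// poweR_ge0.
    rewrite patchE; case: ifPn => [_|/negP tm].
      rewrite muleC; apply: lee_pmul => //.
      - exact: poweR_ge0.
      - by rewrite lee_fin w_ge0.
      - rewrite -poweR_EFin; apply: gt0_ler_poweR.
        + exact: ltW.
        + by rewrite in_itv/= rearrangement_ge0 leey.
        + by rewrite in_itv/= lee_fin s_ge0 leey.
        + by apply: (@rearrangement_le set0) => //; rewrite measure0 lee_fin ltW.
    rewrite mule0 (_ : rearrangement mu f t = 0).
      by rewrite poweR0r ?gt_eqF// mule0.
    apply/eqP; rewrite eq_le rearrangement_ge0 andbT.
    apply: (@rearrangement_le E) => // [|x Ex]; last by rewrite fE// normr0.
    apply: le_trans Em _; rewrite lee_fin leNgt; apply/negP => tm'; apply: tm.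
    by rewrite inE/= in_itv/=.
  - exact: cut_meas.
  - by move=> t _; exact: cut_ge0.
  - by rewrite lee_fin powR_ge0.
move=> leI; rewrite /lorentz_norm -/I.
have I0 : 0 <= I.
  apply: integral_ge0 => t; rewrite /= in_itv/= andbT => t0.
  by rewrite mule_ge0 ?lee_fin ?w_ge0// poweR_ge0.
apply: (@le_trans _ _ ((((s `^ r)%R)%:E * (m `^ (r / q))%:E) `^ r^-1)).
  apply: gt0_ler_poweR => //; first by rewrite invr_ge0 ltW.
  - by rewrite in_itv/= I0 leey.
  - by rewrite in_itv/= leey -EFinM lee_fin mulr_ge0// powR_ge0.
rewrite -EFinM poweR_EFin powRM ?powR_ge0// -!powRrM mulfV ?gt_eqF//.
by rewrite powRr1// mulrAC mulfV ?gt_eqF// mul1r.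
Qed.

(** Each [mu (A k)^(r/q)] is the integral of the weight up to [mu (A k)]. For [t] below [mu (A k)]
    the rearrangement at [t] is at least [s / 2^(k+1)], so at fixed [t] the terms present are a
    geometric sum bounded by twice the rearrangement. *)
Lemma lorentz_norm_level (A : nat -> set X) n : (forall k, measurable (A k)) ->
  (forall k, mu (A k) < +oo) ->
  (forall k x, A k x -> (s / 2 ^+ k.+1 <= `|f x|)%R) ->
  (\sum_(k < n) (s / 2 ^+ k) `^ r * fine (mu (A k)) `^ (r / q))%:E <=
  (2 `^ r / (1 - 2 `^ (- r)))%:E * lorentz_norm q r mu f `^ r.
Proof.
move=> mA Afin Af.
pose m k := fine (mu (A k)).
have mE k : mu (A k) = (m k)%:E by rewrite fineK// ge0_fin_numE.
have m0 k : (0 <= m k)%R by rewrite fine_ge0.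
pose a k := (s / 2 ^+ k)%R.
have a0 k : (0 <= a k)%R by rewrite divr_ge0// exprn_ge0.
pose I := \int[lebesgue_measure]_(t in `]0%R, +oo[)
     ((r / q * t `^ (r / q - 1))%:E * rearrangement mu f t `^ r).
have I0 : 0 <= I.
  apply: integral_ge0 => t; rewrite /= in_itv/= andbT => t0.
  by rewrite mule_ge0 ?lee_fin ?w_ge0// poweR_ge0.
have -> : lorentz_norm q r mu f `^ r = I.
  by rewrite /lorentz_norm -poweRrM mulVf ?gt_eqF// poweRe1.
have rho1 : (0 < 1 - 2 `^ (- r) :> R)%R.
  by rewrite subr_gt0 powR2N_lt1.
have c0 : (0 < 2 `^ r / (1 - 2 `^ (- r)) :> R)%R.
  by rewrite divr_gt0 ?powR_gt0.
have -> : (\sum_(k < n) a k `^ r * m k `^ (r / q))%:E =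
    \int[lebesgue_measure]_(t in `]0%R, +oo[)
      (\sum_(k < n) (a k `^ r)%:E * cut (m k) t).
  rewrite ge0_integral_sum//; last 2 first.
  - by move=> k; apply: measurable_funeM; exact: cut_meas.
  - by move=> k t _; rewrite mule_ge0// lee_fin powR_ge0.
  rewrite -sumEFin; apply: eq_bigr => k _.
  rewrite ge0_integralZl//; last 2 first.
  - exact: cut_meas.
  - by rewrite lee_fin powR_ge0.
  by rewrite (integral_power_weight rq_gt0 (m0 k)).
rewrite -lee_pdivrMl// -ge0_integralZl//; last 3 first.
- by apply: emeasurable_sum => k; apply: measurable_funeM; exact: cut_meas.
- by move=> t _; apply: sume_ge0 => k _; rewrite mule_ge0// lee_fin powR_ge0.
- by rewrite lee_fin invr_ge0 ltW.
apply: integral_ge0_mono => [t _|t].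
  rewrite mule_ge0 ?lee_fin ?invr_ge0 ?(ltW c0)//.
  by apply: sume_ge0 => k _; rewrite mule_ge0// lee_fin powR_ge0.
rewrite /= in_itv/= andbT => t0.
have [y yE] : exists y, rearrangement mu f t = y%:E.
  exists (fine (rearrangement mu f t)); rewrite fineK// ge0_fin_numE ?rearrangement_ge0//.
  apply: (@le_lt_trans _ _ s%:E); last by rewrite ltry.
  by apply: (@rearrangement_le set0) => //; rewrite measure0 lee_fin ltW.
have y0 : (0 <= y)%R by rewrite -lee_fin -yE rearrangement_ge0.
have lvl k : (t < m k)%R -> (a k <= 2 * y)%R.
  move=> tm; have : (s / 2 ^+ k.+1)%:E <= y%:E.
    by rewrite -yE; apply: (le_rearrangement (mA k) (Af k)); rewrite mE lte_fin.
  by rewrite lee_fin exprSr invfM mulrA ler_pdivrMr// [(2 * y)%R]mulrC.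
have -> : \sum_(k < n) (a k `^ r)%:E * cut (m k) t =
    (w t * \sum_(k < n | (t < m k)%R) a k `^ r)%:E.
  rewrite mulr_sumr [in RHS]big_mkcond/= -sumEFin; apply: eq_bigr => k _.
  rewrite /cut patchE; have [tm|tm] := ltP t (m k).
    by rewrite ifT ?inE/= ?in_itv//= -EFinM mulrC.
  by rewrite ifF ?mule0//; apply/negP; rewrite inE/= in_itv/= ltNge tm.
rewrite yE poweR_EFin -!EFinM lee_fin mulrCA; apply: ler_wpM2l => //.
rewrite mulrC ler_pdivrMr// mulrC mulrAC -powRM//.
have y20 : (0 <= 2 * y)%R by rewrite mulr_ge0.
apply: le_trans (geometric_level_sum n r_gt0 s_ge0 y20).
rewrite big_mkcond [leRHS]big_mkcond; apply: ler_sum => k _.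
case: ifPn => [/lvl ->//|_]; case: ifP => // _; exact: powR_ge0.
Qed.

End rearrangement.

(** * The equivalence *)

Section sup_norm.
Context (R : realType) (X : pointedType).
Implicit Types f : X -> R.

Lemma sup_norm_le f (c : R) : (forall x, `|f x| <= c) -> sup_norm f <= c.
Proof.
by move=> fc; apply: ge_sup => [|_ [x _ <-]//]; exists `|f point|, point.
Qed.

Lemma le_sup_norm f (M : R) x : (forall y, `|f y| <= M) -> `|f x| <= sup_norm f.
Proof. by move=> fM; apply: ub_le_sup; [exists M => _ [y _ <-]|exists x]. Qed.

Lemma sup_norm_ge0 f (M : R) : (forall y, `|f y| <= M) -> 0 <= sup_norm f.
Proof. by move=> fM; apply: le_trans (le_sup_norm point fM). Qed.

End sup_norm.

Section continuous_bounded.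
Context (R : realType) (Omega : ptopologicalType).
Hypothesis Omega_compact : compact [set: Omega].
Local Notation C := (continuousType Omega R).
Implicit Types f g : C.

Lemma cfun_bounded f : exists M, forall x, `|f x| <= M.
Proof.
have /compact_bounded[M [_ MP]] : compact (f @` [set: Omega]).
  by apply: continuous_compact => //; apply: continuous_subspaceT; exact: cts_fun.
by exists (M + 1) => x; apply: (MP (M + 1)); [rewrite ltrDl|exists x].
Qed.

Lemma cfun_le_sup_norm f x : `|f x| <= sup_norm f.
Proof. by have [M fM] := cfun_bounded f; exact: le_sup_norm fM. Qed.

Lemma cfun_sup_norm_ge0 f : 0 <= sup_norm f.
Proof. by have [M fM] := cfun_bounded f; exact: sup_norm_ge0 fM. Qed.

Lemma cfun_sup_norm_eq0 f : sup_norm f = 0 -> f = 0.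
Proof.
move=> f0; apply: cfunP => x; apply/eqP; rewrite -normr_le0 -f0.
exact: cfun_le_sup_norm.
Qed.

Lemma closed_borel (F : set Omega) : closed F -> measurable (F : set (borel Omega)).
Proof.
move=> cF; rewrite -[F]setCK; apply: measurableC; apply: sub_sigma_algebra.
exact: closed_openC.
Qed.

Lemma cfun_measurable f : measurable_fun setT (f : borel Omega -> R).
Proof.
apply: (measurability (@RGenOInfty.G R)) => [|_ [_ [x ->] <-]].
  exact: RGenOInfty.measurableE.
rewrite setTI; apply: sub_sigma_algebra.
rewrite (_ : _ @^-1` _ = [set y | x < f y]); first exact: cfun_open_gt.
by apply/seteqP; split => y /=; rewrite in_itv/= andbT.
Qed.

End continuous_bounded.

(** * The dominating measure *)

Section disjoint_supports_to_measure.
Context (R : realType) (Omega : ptopologicalType).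
Hypothesis Omega_compact : compact [set: Omega].
Hypothesis Omega_hausdorff : hausdorff_space Omega.
Local Notation C := (continuousType Omega R).
Implicit Types f g : C.
Context (L : C -> R) (M alpha C0 : R).
Hypothesis alpha_gt0 : 0 < alpha.
Hypothesis L0 : L 0 = 0.
Hypothesis L_ge0 : forall f, 0 <= L f.
Hypothesis L_subadd : forall f g, L (f + g) <= L f + L g.
Hypothesis L_bounded : forall f, unit_ball f -> L f <= M.
Hypothesis L_disjoint : forall n (f : 'I_n -> C),
  (forall i, unit_ball (f i)) -> trivIset setT (fun i => supp (f i)) ->
  \sum_(i < n) L (f i) `^ alpha <= C0.

(** Duality in [C(Omega)], with the indicators of the supports as constraints, turns the packing
    bound into a positive functional [T]. Any [u >= 0] with [u >= 1] on [supp f] satisfies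
    [b f <= T u], which is what the Riesz measure converts into a bound by [mu (supp f)]. *)
Lemma dominating_measure : exists (K : R) (mu : probability (borel Omega) R),
  0 < K /\ forall f, unit_ball f ->
    ((L f `^ alpha)%:E <= K%:E * mu (supp f))%E.
Proof.
pose K0 := packing_constant alpha C0.
have Kb := packing_bound_supp Omega_compact Omega_hausdorff alpha_gt0 L0 L_ge0
  L_subadd L_bounded L_disjoint.
(* Dividing by a positive constant normalises the packing bound to 1, so that [mu] has mass 1. *)
pose K := `|K0| + 1.
have K_gt0 : 0 < K by rewrite ltr_wpDl.
pose J := {f : C | unit_ball f}.
pose b (j : J) := L (sval j) `^ alpha / K.
have Kb1 : packing_bound (fun (j : J) x => \1_(supp (sval j)) x : R) b 1.
  move=> l l0 l1; rewrite (_ : wsum b l = wsum (fun j => L (sval j) `^ alpha) l / K).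
    rewrite ler_pdivrMr// mul1r; apply: le_trans (Kb l l0 l1) _.
    by rewrite (le_trans (ler_norm _))// lerDl.
  by rewrite /wsum mulr_suml; apply: eq_bigr => i _; rewrite mulrA.
have [||||T [T1 T0 Tb]] := @packing_functional R Omega J _ b _ C
   (fun f x => f x) (cfun_cst Omega 1) point _ _ _ 1 ler01 Kb1.
- by move=> j x; rewrite indicE ler0n.
- by [].
- by [].
- exact: cfun_bounded.
have [mu muP] := riesz_measure Omega_compact Omega_hausdorff T1 T0.
exists K, mu; split => // f bf.
rewrite -lee_pdivrMl// -EFinM mulrC.
apply: muP => [|u u0 u1]; first exact: supp_closed.
apply: (Tb (exist _ f bf)) => x /=; rewrite indicE.
by case: (boolP (x \in supp f)) => [/set_mem/u1//|_]; exact: u0.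
Qed.

End disjoint_supports_to_measure.

Section equivalence.
Context (R : realType) (r p q : R).
Hypotheses (r_gt0 : 0 < r) (r_le_p : r <= p) (p_lt_q : p < q).
Context (Omega : ptopologicalType).
Hypothesis Omega_compact : compact [set: Omega].
Hypothesis Omega_hausdorff : hausdorff_space Omega.
Context (Y : lmodType R) (N : Y -> R).
Hypothesis Y_banach : r_banach r N.
Context (T : {linear continuousType Omega R -> Y}).
Hypothesis T_bounded : exists M, forall f, N (T f) <= M * sup_norm f.
Local Notation C := (continuousType Omega R).
Implicit Types f g : C.

Let p_gt0 : 0 < p. Proof. exact: lt_le_trans r_le_p. Qed.
Let q_gt0 : 0 < q. Proof. exact: lt_trans p_lt_q. Qed.
Let N_ge0 y : 0 <= N y. Proof. exact: quasi_norm_ge0 Y_banach y. Qed.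
Let NZ a y : N (a *: y) = `|a| * N y. Proof. exact: quasi_normZ Y_banach a y. Qed.
Let N0 : N 0 = 0. Proof. by rewrite -(scale0r 0) NZ normr0 mul0r. Qed.
Let NT0 : N (T 0) = 0. Proof. by rewrite linear0 N0. Qed.

Let s_ge0 f : 0 <= sup_norm f.
Proof. exact: cfun_sup_norm_ge0 Omega_compact f. Qed.

Let f_le f x : `|f x| <= sup_norm f.
Proof. exact: cfun_le_sup_norm Omega_compact f x. Qed.

Let T_bounded_pos : exists M, 0 <= M /\ forall f, N (T f) <= M * sup_norm f.
Proof.
have [M MP] := T_bounded; exists `|M|; split => // f.
by apply: le_trans (MP f) _; apply: ler_wpM2r => //; exact: ler_norm.
Qed.

Let ler_pow (x y k : R) : 0 <= k -> 0 <= x -> x <= y -> x `^ k <= y `^ k.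
Proof.
by move=> k0 x0 xy; apply: ge0_ler_powR; rewrite ?nnegrE// (le_trans x0).
Qed.

Let powK (x k : R) : k != 0 -> 0 <= x -> (x `^ k) `^ k^-1 = x.
Proof. by move=> k0 x0; rewrite -powRrM mulfV// powRr1. Qed.

Let powK' (x k : R) : k != 0 -> 0 <= x -> (x `^ k^-1) `^ k = x.
Proof. by move=> k0 x0; rewrite -powRrM mulVf// powRr1. Qed.

Let root_mul (x u v : R) : 0 <= x -> 0 <= u -> 0 <= v ->
  (x * u `^ r * v `^ r) `^ r^-1 = x `^ r^-1 * u * v.
Proof.
move=> x0 u0 v0; have ur := powR_ge0 u r; have vr := powR_ge0 v r.
rewrite (powRM _ (mulr_ge0 x0 ur) vr) (powRM _ x0 ur).
by rewrite (@powK u r) ?gt_eqF// (@powK v r) ?gt_eqF.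
Qed.

Definition disjoint_estimate (C1 : R) :=
  forall (n : nat) (f : 'I_n -> C), trivIset setT (fun i => supp (f i)) ->
  (\sum_(i < n) N (T (f i)) `^ q) `^ q^-1
    <= C1 * \big[Num.max/0]_(i < n) sup_norm (f i).

Definition supp_estimate (K : R) (mu : probability (borel Omega) R) :=
  forall f, N (T f) <= K * sup_norm f * fine (mu (supp f)) `^ q^-1.

Lemma sup_norm_unit_ball f : unit_ball f -> sup_norm f <= 1.
Proof. exact: sup_norm_le. Qed.

(** With [L f = N (T f)^r] and [alpha = q / r], the sums of [L^alpha] are those of condition (i).
    Homogeneity of [T] and [N] carries the bound from the unit ball to all [f]. *)
Lemma disjoint_supp_estimate C1 : disjoint_estimate C1 ->
  exists K mu, 0 < K /\ supp_estimate K mu.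
Proof.
move=> H1; pose L f := N (T f) `^ r.
have [M [M0 MP]] := T_bounded_pos.
pose alpha := q / r.
have LN f : L f `^ alpha = N (T f) `^ q.
  by rewrite /L -powRrM /alpha mulrC divfK ?gt_eqF.
have [||||||K [mu [K0 Kmu]]] := @dominating_measure R Omega Omega_compact
  Omega_hausdorff L (M `^ r) alpha (`|C1| `^ q).
- exact: divr_gt0.
- by rewrite /L NT0 powR0 ?gt_eqF.
- by move=> f; exact: powR_ge0.
- by move=> f g; rewrite /L linearD; exact: r_triangle Y_banach _ _.
- move=> f bf; apply: ler_pow => //; first exact: ltW.
  by apply: le_trans (MP f) _; rewrite ler_piMr// sup_norm_unit_ball.
- move=> n f bf tf; under eq_bigr do rewrite LN.
  set S := \sum_(i < n) _.
  have S0 : 0 <= S by apply: sumr_ge0 => i _; exact: powR_ge0.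
  rewrite -[S](@powK' _ q) ?gt_eqF//; apply: ler_pow; rewrite ?powR_ge0 ?(ltW q_gt0)//.
  apply: le_trans (H1 n f tf) _; rewrite -[leRHS]mulr1.
  set m := \big[Num.max/0]_(i < n) _.
  have m0 : 0 <= m by exact: bigmax_ge_id.
  apply: le_trans (ler_wpM2r m0 (ler_norm C1)) _; apply: ler_wpM2l => //.
  by apply: bigmax_le => // i _; exact: sup_norm_unit_ball.
exists (K `^ q^-1), mu; split; first exact: powR_gt0.
move=> f.
have [f0|s0] := eqVneq (sup_norm f) 0.
  rewrite (cfun_sup_norm_eq0 Omega_compact f0) NT0.
  by rewrite mulr_ge0 ?powR_ge0// mulr_ge0 ?powR_ge0.
have sp : 0 < sup_norm f by rewrite lt_neqAle eq_sym s0 s_ge0.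
pose g := (sup_norm f)^-1 *: f.
have bg : unit_ball g.
  by move=> x; rewrite cfunZE normrM ger0_norm ?invr_ge0// ler_pdivrMl// mulr1.
have sg : supp g `<=` supp f.
  apply: supp_subset => [|x]; first exact: supp_closed.
  by rewrite cfunZE mulf_eq0 negb_or => /andP[_]; exact: supp_in.
have -> : N (T f) = sup_norm f * N (T g).
  by rewrite /g linearZ/= NZ ger0_norm ?invr_ge0// mulrA mulfV// mul1r.
rewrite [_ * sup_norm f]mulrC -mulrA; apply: ler_wpM2l => //.
have mK : (mu (supp f) = (fine (mu (supp f)))%:E)%E.
  by rewrite fineK// fin_num_measure//; apply: closed_borel; exact: supp_closed.
have m0 : 0 <= fine (mu (supp f)) by rewrite fine_ge0.
rewrite -powRM ?(ltW K0)// -[leLHS](@powK _ q) ?gt_eqF//.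
apply: ler_pow; rewrite ?invr_ge0 ?powR_ge0 ?(ltW q_gt0)//.
rewrite -LN -lee_fin EFinM -mK; apply: le_trans (Kmu g bg) _.
apply: lee_pmul => //; first by rewrite lee_fin ltW.
by apply: le_measure => //; rewrite inE; apply: closed_borel; exact: supp_closed.
Qed.

(** * From supports to integrals and Lorentz quasi-norms *)

Section supp_estimate_consequences.
Context (K : R) (mu : probability (borel Omega) R).
Hypothesis K_gt0 : 0 < K.
Hypothesis K_mu : supp_estimate K mu.

Let level f k : set Omega := [set x | sup_norm f / 2 ^+ k.+1 <= `|f x|].

Let level_closed f k : closed (level f k).
Proof.
apply: (@preimage_closed _ _ (fun x => `|f x|) [set y | _ <= y]); last exact: closed_ge.
move=> x _; apply: continuous_comp; first exact: cts_fun.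
exact: norm_continuous.
Qed.

Let level_measurable f k : measurable (level f k : set (borel Omega)).
Proof. by apply: closed_borel; exact: level_closed. Qed.

Let mu_fin (A : set (borel Omega)) : measurable A -> mu A = (fine (mu A))%:E.
Proof. by move=> mA; rewrite fineK// fin_num_measure. Qed.

Let a_ge0 f k : 0 <= sup_norm f / 2 ^+ k.
Proof. by rewrite divr_ge0// exprn_ge0. Qed.

(** Telescoping over clampings of [f] at the heights [s / 2^k]: the difference of two consecutive
    ones has norm at most [s / 2^k] and lives where [|f| >= s / 2^(k+1)], so the support estimate
    applies to it. *)
Lemma dyadic_decomposition f n :
  N (T f) `^ r <= K `^ r * \sum_(k < n) (sup_norm f / 2 ^+ k) `^ r *
      fine (mu (level f k)) `^ (r / q) +
    N (T (cfun_clamp (- (sup_norm f / 2 ^+ n)) (sup_norm f / 2 ^+ n) f)) `^ r.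
Proof.
set s := sup_norm f.
have s0 : 0 <= s by exact: s_ge0.
pose c k := cfun_clamp (- (s / 2 ^+ k)) (s / 2 ^+ k) f.
elim: n => [|n IH].
  rewrite big_ord0 mulr0 add0r expr0 divr1 (_ : cfun_clamp _ _ _ = f)//.
  apply: cfunP => x; have := f_le f x; rewrite -/s ler_norml => /andP[fs1 fs2].
  rewrite (_ : cfun_clamp _ _ _ x = Num.max (- s) (Num.min s (f x)))//.
  by rewrite (min_idPr fs2); exact/max_idPr.
apply: le_trans IH _; rewrite big_ord_recr/= mulrDr -addrA lerD2l.
have cE : c n = (c n - c n.+1) + c n.+1 by rewrite subrK.
rewrite -/(c n) {1}cE linearD.
apply: le_trans (r_triangle Y_banach _ _) _; rewrite lerD2r.
have aS : s / 2 ^+ n.+1 = s / 2 ^+ n / 2 by rewrite exprSr invfM mulrA.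
have an0 : 0 <= s / 2 ^+ n by exact: a_ge0.
have cx k x : c k x = Num.max (- (s / 2 ^+ k)) (Num.min (s / 2 ^+ k) (f x)) by [].
have dle x : `|(c n - c n.+1) x| <= s / 2 ^+ n.
  rewrite cfunDE cfunNE !cx aS ler_norml /Num.max /Num.min; move: (s / _) an0 => a an0.
  by repeat case: ifP => /=; lra.
have dsupp : supp (c n - c n.+1) `<=` level f n.
  apply: supp_subset => [|x]; first exact: level_closed.
  rewrite /level/= -/s cfunDE cfunNE !cx.
  apply: contra_neqT; rewrite -ltNge ltr_norml aS /Num.max /Num.min.
  by move: (s / _) an0 => a an0; repeat case: ifP => /=; lra.
have m0 : 0 <= fine (mu (level f n)) by rewrite fine_ge0.
have msub : fine (mu (supp (c n - c n.+1))) <= fine (mu (level f n)).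
  have mS : measurable (supp (c n - c n.+1) : set (borel Omega)).
    by apply: closed_borel; exact: supp_closed.
  by rewrite -lee_fin -!mu_fin//; apply: le_measure; rewrite ?inE.
have -> : r / q = q^-1 * r by rewrite mulrC.
rewrite powRrM -!powRM ?mulr_ge0 ?powR_ge0// ?(ltW K_gt0)//.
apply: ler_pow; [exact: ltW|exact: N_ge0|].
apply: le_trans (K_mu _) _; rewrite [leRHS]mulrA.
apply: ler_pM; rewrite ?mulr_ge0 ?powR_ge0 ?s_ge0// ?(ltW K_gt0)//.
  by rewrite ler_pM2l//; exact: sup_norm_le.
by apply: ler_pow; rewrite ?invr_ge0 ?(ltW q_gt0)// fine_ge0.
Qed.

Lemma le_geometric_error (x b c z : R) : 0 <= z < 1 ->
  (forall n, x <= b + c * z ^+ n) -> x <= b.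
Proof.
move=> /andP[z0 z1] xb; rewrite -subr_le0.
have z1' : `|z| < 1 by rewrite ger0_norm.
apply: (cvgr_to_ge (cvg_geometric c z1')); near=> n.
by rewrite /geometric /= lerBlDl.
Unshelve. all: by end_near. Qed.

(** By boundedness of [T] the clamped remainder contributes at most [(M s / 2^n)^r], which tends to
    0. *)
Lemma dyadic_estimate f (b : R) :
  (forall n, \sum_(k < n) (sup_norm f / 2 ^+ k) `^ r *
      fine (mu (level f k)) `^ (r / q) <= b) ->
  N (T f) `^ r <= K `^ r * b.
Proof.
move=> fb; have [M [M0 MP]] := T_bounded_pos.
set s := sup_norm f in fb *.
apply: (@le_geometric_error _ _ ((M * s) `^ r) (2 `^ (- r))).
  by rewrite powR_ge0 powR2N_lt1.
move=> n; apply: le_trans (dyadic_decomposition f n) _; apply: lerD.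
  by rewrite ler_pM2l ?powR_gt0//; exact: fb.
have -> : (2 `^ (- r) : R) ^+ n = (2 ^- n) `^ r.
  have -> : (2 ^- n : R) = 2 `^ (- n%:R) by rewrite powR_invn.
  by rewrite -powRrM mulNr mulrC -mulNr powRrM powR_mulrn// powR_ge0.
have an0 : 0 <= s / 2 ^+ n by exact: a_ge0.
rewrite -powRM ?mulr_ge0 ?s_ge0 ?invr_ge0 ?exprn_ge0//.
apply: ler_pow; [exact: ltW|exact: N_ge0|].
apply: le_trans (MP _) _; rewrite -mulrA; apply: ler_wpM2l => //.
apply: sup_norm_le => x.
rewrite (_ : cfun_clamp _ _ _ x =
  Num.max (- (s / 2 ^+ n)) (Num.min (s / 2 ^+ n) (f x)))//.
rewrite ler_norml /Num.max /Num.min; move: (s / _) an0 => a an0.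
by repeat case: ifP => /=; lra.
Qed.

Lemma supp_estimate_integral : exists (C3 : R),
  forall f, ((N (T f))%:E <= (C3 * sup_norm f `^ (1 - p / q))%:E
             * (\int[mu]_x (`|f x| `^ p)%:E) `^ q^-1)%E.
Proof.
(* [theta] is what remains of the exponent [r] once [p r / q] is spent on Chebyshev's inequality;
   [p < q] makes it positive, and the levels then sum geometrically. *)
pose theta := r * (1 - p / q).
have theta0 : 0 < theta by rewrite mulr_gt0// subr_gt0 ltr_pdivrMr// mul1r.
pose D := K `^ r * (2 `^ p) `^ (r / q) / (1 - 2 `^ (- theta)).
have rho : 0 < 1 - 2 `^ (- theta) :> R by rewrite subr_gt0 powR2N_lt1.
have D0 : 0 <= D by rewrite divr_ge0 ?mulr_ge0 ?powR_ge0// ltW.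
exists (D `^ r^-1) => f; set s := sup_norm f.
pose I := (\int[mu]_x (`|f x| `^ p)%:E)%E.
have I_ge (A : set (borel Omega)) (c : R) : measurable A -> 0 <= c ->
    (forall x, A x -> c <= `|f x|) -> ((c `^ p)%:E * mu A <= I)%E.
  move=> mA c0 Ac; rewrite -integral_cst//.
  rewrite integral_mkcond; apply: integral_ge0_mono => x _.
    by rewrite patchE; case: ifP => //; rewrite lee_fin powR_ge0.
  rewrite patchE; case: ifPn => [/set_mem Ax|_]; rewrite lee_fin ?powR_ge0//.
  by apply: ler_pow; [exact: ltW| |exact: Ac].
have I0 : (0 <= I)%E by apply: integral_ge0 => x _; rewrite lee_fin powR_ge0.
have Ifin : I = (fine I)%:E.
  rewrite fineK// ge0_fin_numE//.
  apply: (@le_lt_trans _ _ (\int[mu]_x (cst (s `^ p)%:E x))%E).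
    apply: integral_ge0_mono => x _; rewrite lee_fin ?powR_ge0//.
    by apply: ler_pow; [exact: ltW|exact: normr_ge0|exact: f_le].
  rewrite integral_cst//; apply: (@le_lt_trans _ _ ((s `^ p)%:E * 1)%E).
    apply: lee_wpmul2l; first by rewrite lee_fin powR_ge0.
    exact: probability_le1.
  by rewrite mule1 ltry.
rewrite -/I Ifin poweR_EFin -EFinM lee_fin; set A := fine I.
have A0 : 0 <= A by rewrite fine_ge0.
have sp0 : 0 <= s by exact: s_ge0.
have m0 k : 0 <= fine (mu (level f k)) by rewrite fine_ge0.
(* Chebyshev: [(s / 2^(k+1))^p mu (level f k) <= A], raised to the power [r / q]. *)
have term k : (s / 2 ^+ k) `^ r * fine (mu (level f k)) `^ (r / q) <=
    (2 `^ p * A) `^ (r / q) * (s / 2 ^+ k) `^ theta.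
  have -> : (s / 2 ^+ k) `^ r =
      (s / 2 ^+ k) `^ (p * (r / q)) * (s / 2 ^+ k) `^ theta.
    have eqr : p * (r / q) + theta = r by rewrite /theta; field; rewrite gt_eqF.
    by rewrite -powRD ?eqr// gt_eqF.
  rewrite mulrAC; apply: ler_wpM2r; first exact: powR_ge0.
  rewrite powRrM -powRM ?powR_ge0//.
  apply: ler_pow; [by rewrite ltW// divr_gt0|by rewrite mulr_ge0 ?powR_ge0|].
  have aS : s / 2 ^+ k = 2 * (s / 2 ^+ k.+1).
    by rewrite exprSr invfM; field; rewrite expf_neq0.
  rewrite aS powRM//; last exact: a_ge0.
  rewrite -mulrA ler_pM2l ?powR_gt0// -lee_fin EFinM -mu_fin// -Ifin.
  by apply: I_ge => //; exact: a_ge0.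
have sumle n : \sum_(k < n) (s / 2 ^+ k) `^ r * fine (mu (level f k)) `^ (r / q) <=
    (2 `^ p * A) `^ (r / q) * (s `^ theta / (1 - 2 `^ (- theta))).
  apply: (@le_trans _ _ ((2 `^ p * A) `^ (r / q) * \sum_(k < n) (s / 2 ^+ k) `^ theta)).
    by rewrite mulr_sumr; apply: ler_sum => k _; exact: term.
  apply: ler_wpM2l; first exact: powR_ge0.
  apply: le_trans (geometric_level_sum n theta0 sp0 sp0).
  rewrite [leRHS](eq_bigl xpredT)// => k.
  by rewrite ler_pdivrMr ?exprn_gt0// ler_peMr// exprn_ege1// ler1n.
have := dyadic_estimate sumle.
have -> : K `^ r * ((2 `^ p * A) `^ (r / q) * (s `^ theta / (1 - 2 `^ (- theta)))) =
    D * (s `^ (1 - p / q)) `^ r * (A `^ q^-1) `^ r.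
  have -> : (2 `^ p * A) `^ (r / q) = (2 `^ p) `^ (r / q) * (A `^ q^-1) `^ r.
    by rewrite powRM ?powR_ge0// -(powRrM A) [q^-1 * r]mulrC.
  have -> : s `^ theta = (s `^ (1 - p / q)) `^ r by rewrite -powRrM /theta mulrC.
  rewrite /D; move: (K `^ r) ((2 `^ p) `^ (r / q)) ((A `^ q^-1) `^ r)
    ((s `^ (1 - p / q)) `^ r) (1 - 2 `^ (- theta)) => x1 x2 x3 x4 x5; ring.
move=> le; rewrite -[leLHS](@powK _ r) ?gt_eqF//.
rewrite -root_mul ?powR_ge0//.
apply: ler_pow; [by rewrite invr_ge0 ltW|exact: powR_ge0|exact: le].
Qed.

Lemma supp_estimate_lorentz : exists (C4 : R),
  forall f, ((N (T f))%:E <= C4%:E * lorentz_norm q r mu f)%E.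
Proof.
pose c : R := 2 `^ r / (1 - 2 `^ (- r)).
have c0 : 0 < c by rewrite divr_gt0 ?powR_gt0// subr_gt0 powR2N_lt1.
have D0 : 0 < K `^ r * c by rewrite mulr_gt0// powR_gt0.
exists ((K `^ r * c) `^ r^-1) => f.
have l0 : (0 <= lorentz_norm q r mu f)%E by exact: poweR_ge0.
have [lfin|] := boolP (lorentz_norm q r mu f \is a fin_num); last first.
  rewrite ge0_fin_numE// -leNgt leye_eq => /eqP ->.
  by rewrite gt0_muley ?lte_fin ?powR_gt0// leey.
pose l := fine (lorentz_norm q r mu f).
have lE : (l%:E = lorentz_norm q r mu f)%E by rewrite fineK.
rewrite -lE; rewrite -lE lee_fin in l0.
have le n : \sum_(k < n) (sup_norm f / 2 ^+ k) `^ r *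
    fine (mu (level f k)) `^ (r / q) <= c * l `^ r.
  rewrite -lee_fin EFinM -poweR_EFin /l lE.
  by apply: lorentz_norm_level => //= k; rewrite mu_fin// ltry.
rewrite -EFinM lee_fin -[leLHS](@powK _ r) ?gt_eqF//.
rewrite -[X in _ <= _ * X](@powK l r) ?gt_eqF// -powRM ?powR_ge0 ?(ltW D0)//.
apply: ler_pow; rewrite ?invr_ge0 ?powR_ge0 ?(ltW r_gt0)// -mulrA.
exact: dyadic_estimate.
Qed.

End supp_estimate_consequences.

Definition square_estimate (C2 : R) :=
  forall (n : nat) (f : 'I_n -> C),
  (\sum_(i < n) N (T (f i)) `^ q) `^ q^-1
    <= C2 * sup_norm (fun x => (\sum_(i < n) `|f i x| `^ p) `^ p^-1).

Definition interpolation_estimate (C3 : R) (mu : probability (borel Omega) R) :=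
  forall f, ((N (T f))%:E <= (C3 * sup_norm f `^ (1 - p / q))%:E
             * (\int[mu]_x (`|f x| `^ p)%:E) `^ q^-1)%E.

Definition lorentz_estimate (C4 : R) (mu : probability (borel Omega) R) :=
  forall f, ((N (T f))%:E <= C4%:E * lorentz_norm q r mu f)%E.

(** * Estimates for finite families of functions *)

Section square_function.
Context (n : nat) (f : 'I_n -> C).

Let F x := (\sum_(i < n) `|f i x| `^ p) `^ p^-1.

Let F_ge0 x : 0 <= F x. Proof. exact: powR_ge0. Qed.

(** Boundedness must come first: only then does [sup_norm F] dominate the values of [F]. *)
Let F_bounded : exists M, forall x, `|F x| <= M.
Proof.
exists ((\sum_(i < n) sup_norm (f i) `^ p) `^ p^-1) => x.
rewrite (ger0_norm (F_ge0 x)); apply: ler_pow.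
- by rewrite invr_ge0 ltW.
- by apply: sumr_ge0 => i _; exact: powR_ge0.
- by apply: ler_sum => i _; apply: ler_pow; [exact: ltW|exact: normr_ge0|exact: f_le].
Qed.

Let S := sup_norm F.

Let F_le x : F x <= S.
Proof.
by have [M FM] := F_bounded; rewrite -[F x]ger0_norm//; exact: le_sup_norm FM.
Qed.

Let S_ge0 : 0 <= S.
Proof. exact: le_trans (F_ge0 point) (F_le point). Qed.

Let sum_pow_le x : \sum_(i < n) `|f i x| `^ p <= S `^ p.
Proof.
rewrite -[leLHS](@powK' _ p) ?gt_eqF//; last first.
  by apply: sumr_ge0 => i _; exact: powR_ge0.
by apply: ler_pow; [exact: ltW|exact: F_ge0|exact: F_le].
Qed.

Let sup_norm_le_S i : sup_norm (f i) <= S.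
Proof.
apply: sup_norm_le => x; apply: le_trans (F_le x).
rewrite -[leLHS](@powK _ p) ?gt_eqF//; apply: ler_pow.
- by rewrite invr_ge0 ltW.
- exact: powR_ge0.
- by rewrite (bigD1 i)//= lerDl; apply: sumr_ge0 => j _; exact: powR_ge0.
Qed.

(** In the [q]-th power of (iii), the factor [sup_norm (f i)^(q - p)] is at most [S^(q - p)], and
    the integrals of [|f i|^p] add up to at most [S^p] because [mu] is a probability. *)
Lemma interpolation_square C3 mu : interpolation_estimate C3 mu ->
  (\sum_(i < n) N (T (f i)) `^ q) `^ q^-1 <= `|C3| * S.
Proof.
move=> H3.
pose I i := (\int[mu]_x (`|f i x| `^ p)%:E)%E.
have pow_meas i : measurable_fun setT (fun x : borel Omega => (`|f i x| `^ p)%:E).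
  apply/measurable_EFinP; apply: (measurableT_comp (measurable_powR p)) => //.
  by apply: measurableT_comp => //; exact: cfun_measurable.
have I0 i : (0 <= I i)%E by apply: integral_ge0 => x _; rewrite lee_fin powR_ge0.
have sumI : (\sum_(i < n) I i <= (S `^ p)%:E)%E.
  rewrite -ge0_integral_sum//.
  apply: (@le_trans _ _ (\int[mu]_x (cst (S `^ p)%:E x))%E).
    apply: integral_ge0_mono => x _; last by rewrite sumEFin lee_fin.
    by apply: sume_ge0 => i _; rewrite lee_fin powR_ge0.
  rewrite integral_cst//; apply: (@le_trans _ _ ((S `^ p)%:E * 1)%E).
    apply: lee_wpmul2l; first by rewrite lee_fin powR_ge0.
    exact: probability_le1.
  by rewrite mule1.
have Ifin i : I i = (fine (I i))%:E.
  rewrite fineK// ge0_fin_numE//; apply: le_lt_trans (ltry (S `^ p)).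
  apply: le_trans sumI; rewrite (bigD1 i)//= leeDl//.
  by apply: sume_ge0 => j _.
have fI0 i : 0 <= fine (I i) by rewrite fine_ge0.
have N_le i : N (T (f i)) `^ q <= `|C3| `^ q * S `^ (q - p) * fine (I i).
  have Sq : 0 <= S `^ (1 - p / q) by exact: powR_ge0.
  have -> : S `^ (q - p) = (S `^ (1 - p / q)) `^ q.
    by rewrite -powRrM mulrBl mul1r divfK ?gt_eqF.
  rewrite -[fine (I i)](@powK' _ q) ?gt_eqF// -!powRM ?mulr_ge0 ?powR_ge0//.
  apply: ler_pow; [exact: ltW|exact: N_ge0|].
  rewrite -lee_fin; apply: le_trans (H3 (f i)) _.
  rewrite -/(I i) Ifin poweR_EFin -EFinM lee_fin; apply: ler_wpM2r; first exact: powR_ge0.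
  apply: le_trans (ler_wpM2r (powR_ge0 _ _) (ler_norm C3)) _.
  apply: ler_wpM2l => //; apply: ler_pow => //.
  by rewrite subr_ge0 ler_pdivrMr// mul1r ltW.
have sum0 : 0 <= \sum_(i < n) N (T (f i)) `^ q.
  by apply: sumr_ge0 => i _; exact: powR_ge0.
have CS0 : 0 <= `|C3| * S by rewrite mulr_ge0.
rewrite -[leRHS](@powK _ q) ?gt_eqF//; apply: ler_pow => //.
  by rewrite invr_ge0 ltW.
apply: (@le_trans _ _ (\sum_(i < n) `|C3| `^ q * S `^ (q - p) * fine (I i))).
  by apply: ler_sum => i _.
rewrite -mulr_sumr powRM// -mulrA ler_wpM2l ?powR_ge0//.
apply: (@le_trans _ _ (S `^ (q - p) * S `^ p)).
  rewrite ler_wpM2l ?powR_ge0// -lee_fin -sumEFin.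
  by under eq_bigr do rewrite -Ifin.
rewrite -powRD subrK// gt_eqF//.
Qed.

(** At each point at most one [f i] is nonzero, so [F] equals some [|f i|] or 0 there. *)
Lemma square_sup_norm_disjoint : trivIset setT (fun i => supp (f i)) ->
  S <= \big[Num.max/0]_(i < n) sup_norm (f i).
Proof.
move=> tf; set m := \big[Num.max/0]_(i < n) _.
have m0 : 0 <= m by exact: bigmax_ge_id.
apply: sup_norm_le => x; rewrite ger0_norm//.
have [[i fix0]|nf] := pselect (exists i, f i x != 0); last first.
  rewrite /F big1 ?powR0 ?invr_eq0 ?gt_eqF// => i _.
  have -> : f i x = 0 by apply/eqP/negPn/negP => fi; apply: nf; exists i.
  by rewrite normr0 powR0 ?gt_eqF.
rewrite /F (bigD1 i)//= big1 ?addr0 => [|j ji].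
  rewrite powK ?gt_eqF//; apply: le_trans (f_le (f i) x) _.
  exact: (le_bigmax _ (fun i => sup_norm (f i))).
have -> : f j x = 0.
  apply/eqP/negPn/negP => fjx; move: ji; rewrite (tf j i I I) ?eqxx//.
  by exists x; split; exact: supp_in.
by rewrite normr0 powR0 ?gt_eqF.
Qed.

Lemma square_disjoint C2 : square_estimate C2 ->
  trivIset setT (fun i => supp (f i)) ->
  (\sum_(i < n) N (T (f i)) `^ q) `^ q^-1
    <= `|C2| * \big[Num.max/0]_(i < n) sup_norm (f i).
Proof.
move=> H2 tf; apply: le_trans (H2 n f) _.
apply: le_trans (ler_wpM2r S_ge0 (ler_norm C2)) _; apply: ler_wpM2l => //.
exact: square_sup_norm_disjoint.
Qed.

(** Since [f i] vanishes off its support, its Lorentz quasi-norm is at most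
    [m mu (supp (f i))^(1/q)]; the measures of disjoint supports add up to at most 1. *)
Lemma lorentz_disjoint C4 mu : lorentz_estimate C4 mu ->
  trivIset setT (fun i => supp (f i)) ->
  (\sum_(i < n) N (T (f i)) `^ q) `^ q^-1
    <= `|C4| * \big[Num.max/0]_(i < n) sup_norm (f i).
Proof.
move=> H4 tf; set m := \big[Num.max/0]_(i < n) _.
have m0 : 0 <= m by exact: bigmax_ge_id.
have suppm i : measurable (supp (f i) : set (borel Omega)).
  by apply: closed_borel; exact: supp_closed.
have mE i : mu (supp (f i)) = (fine (mu (supp (f i))))%:E.
  by rewrite fineK// fin_num_measure.
have fm0 i : 0 <= fine (mu (supp (f i))) by rewrite fine_ge0.
have summ : \sum_(i < n) fine (mu (supp (f i))) <= 1.
  rewrite -lee_fin -sumEFin; under eq_bigr do rewrite -mE.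
  rewrite -(@measure_bigsetU_ord_cond _ _ _ mu n xpredT (fun i => supp (f i)))//.
    by apply: probability_le1; apply: bigsetU_measurable.
  by move=> i j _ _; exact: tf.
have N_le i : N (T (f i)) `^ q <= (`|C4| * m) `^ q * fine (mu (supp (f i))).
  rewrite -[fine _](@powK' _ q) ?gt_eqF// -powRM ?mulr_ge0 ?powR_ge0//.
  apply: ler_pow; [exact: ltW|exact: N_ge0|].
  rewrite -lee_fin; apply: le_trans (H4 (f i)) _.
  have l0 : (0 <= lorentz_norm q r mu (f i))%E by exact: poweR_ge0.
  apply: (@le_trans _ _ (`|C4|%:E * lorentz_norm q r mu (f i))%E).
    by apply: lee_wpmul2r => //; rewrite lee_fin ler_norm.
  rewrite -mulrA EFinM; apply: lee_wpmul2l; first by rewrite lee_fin.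
  have mle : (mu (supp (f i)) <= (fine (mu (supp (f i))))%:E)%E by rewrite -mE.
  apply: le_trans (@lorentz_norm_le _ (borel Omega) R mu (f i) q r _ q_gt0
    r_gt0 (f_le (f i)) _ _ (suppm i) mle (@supp_out _ _ (f i))) _.
  rewrite lee_fin ler_wpM2r ?powR_ge0//.
  exact: (le_bigmax _ (fun i => sup_norm (f i))).
have sum0 : 0 <= \sum_(i < n) N (T (f i)) `^ q.
  by apply: sumr_ge0 => i _; exact: powR_ge0.
have Cm0 : 0 <= `|C4| * m by rewrite mulr_ge0.
rewrite -[leRHS](@powK _ q) ?gt_eqF//; apply: ler_pow => //.
  by rewrite invr_ge0 ltW.
apply: le_trans (ler_sum _ (fun i _ => N_le i)) _.
by rewrite -mulr_sumr ler_piMr// powR_ge0.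
Qed.

End square_function.

End equivalence.

Theorem theorem4p1 (R : realType) (r p q : R)
    (r_gt0 : 0 < r) (r_le_p : r <= p) (p_lt_q : p < q) (r_le1 : r <= 1)
    (Omega : ptopologicalType)
    (Omega_compact : compact [set: Omega]) (Omega_hausdorff : hausdorff_space Omega)
    (Y : lmodType R) (N : Y -> R) (Y_banach : r_banach r N)
    (T : {linear continuousType Omega R -> Y})
    (T_bounded : exists M, forall f, N (T f) <= M * sup_norm f) :
  [<->
    (* (i) *)
    exists C1 : R, forall (n : nat) (f : 'I_n -> continuousType Omega R),
      trivIset setT (fun i => supp (f i)) ->
      (\sum_(i < n) N (T (f i)) `^ q) `^ q^-1
        <= C1 * \big[Num.max/0]_(i < n) sup_norm (f i);
    (* (ii) *)
    exists C2 : R, forall (n : nat) (f : 'I_n -> continuousType Omega R),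
      (\sum_(i < n) N (T (f i)) `^ q) `^ q^-1
        <= C2 * sup_norm (fun x => (\sum_(i < n) `|f i x| `^ p) `^ p^-1);
    (* (iii) *)
    exists (C3 : R) (mu : probability (borel Omega) R),
      forall f : continuousType Omega R,
        ((N (T f))%:E
          <= (C3 * sup_norm f `^ (1 - p / q))%:E
             * (\int[mu]_x (`|f x| `^ p)%:E) `^ q^-1)%E;
    (* (iv) *)
    exists (C4 : R) (mu : probability (borel Omega) R),
      forall f : continuousType Omega R,
        ((N (T f))%:E <= C4%:E * lorentz_norm q r mu f)%E
  ].
Proof.
have disjoint_supp : (exists C1, disjoint_estimate q N T C1) ->
    exists K mu, 0 < K /\ supp_estimate q N T K mu.
  by move=> [C1]; apply: (disjoint_supp_estimate r_gt0 r_le_p p_lt_q).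
have square_disjoint_ex : (exists C2, square_estimate p q N T C2) ->
    exists C1, disjoint_estimate q N T C1.
  move=> [C2 H2]; exists `|C2| => n f.
  exact: (square_disjoint r_gt0 r_le_p Omega_compact).
have supp_interpolation : (exists K mu, 0 < K /\ supp_estimate q N T K mu) ->
    exists C3 mu, interpolation_estimate p q N T C3 mu.
  move=> [K [mu [K0 H]]].
  have [C3 H3] := supp_estimate_integral r_gt0 r_le_p p_lt_q Omega_compact
    Y_banach T_bounded K0 H.
  by exists C3, mu.
have supp_lorentz : (exists K mu, 0 < K /\ supp_estimate q N T K mu) ->
    exists C4 mu, lorentz_estimate r q N T C4 mu.
  move=> [K [mu [K0 H]]].
  have [C4 H4] := supp_estimate_lorentz r_gt0 r_le_p p_lt_q Omega_compact
    Y_banach T_bounded K0 H.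
  by exists C4, mu.
have interpolation_square_ex : (exists C3 mu, interpolation_estimate p q N T C3 mu) ->
    exists C2, square_estimate p q N T C2.
  move=> [C3 [mu H3]]; exists `|C3| => n f.
  exact: (interpolation_square r_gt0 r_le_p p_lt_q Omega_compact Y_banach).
(* The implications form the cycle (i), (ii), (iii), (iv). The support estimate is obtained from
   (i), so the steps to (iii) and to (iv) first return to (i). *)
tfae.
- by move=> /disjoint_supp/supp_interpolation/interpolation_square_ex.
- by move=> /square_disjoint_ex/disjoint_supp/supp_interpolation.
- by move=> /interpolation_square_ex/square_disjoint_ex/disjoint_supp/supp_lorentz.
- move=> [C4 [mu H4]]; exists `|C4| => n f tf.
  exact: (lorentz_disjoint r_gt0 r_le_p p_lt_q Omega_compact Y_banach H4).
Qed.
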